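(* The extended phase is a closed and non-empty subset of $\mathcal T$.
   Context: Let $\mathcal L=2\mathbb Z^3\cup(2\mathbb Z^3+(1,1,1))$ and consider its Voronoi tessellation of $\mathbb R^3$ (by truncated octahedra). Cells are indexed by their centers $v\in\mathcal L$; cells $v,w$ are adjacent (share a face) iff $v-w\in\{(\pm2,0,0),(0,\pm2,0),(0,0,\pm2)\}$ or $v-w\in\{(\pm1,\pm1,\pm1)\}$. Faces, edges and vertices of the tessellation correspond bijectively to sets of $2$, $3$ and $4$ mutually adjacent cells respectively; incidence corresponds to inclusion. Let $\mathcal T=\{p\in[0,1]^3:p_1+p_2+p_3=1\}$. For $p\in\mathcal T$, $\mathbb P_p$ is the law of the random coloring in which each cell independently gets color $i\in\{1,2,3\}$ (red, yellow, blue) with probability $p_i$. A tricolor edge is an edge of the tessellation whose three incident cells have three different colors; a tricolor vertex is a vertex incident to cells of all three colors. Each tricolor vertex is incident to exactly two tricolor edges and each tricolor edge to two tricolor vertices, so tricolor edges form disjoint loops and/or infinite paths. A tricolor path is a path (along the edges of the tessellation) of tricolor edges. For $n\ge1$ an integer, let $A_n=([-3n,3n]^3\setminus[-n,n]^3)\cap\mathcal L$. $E_n$ is the event that there is a tricolor path from a vertex on the interior boundary of $A_n$ (a vertex of the tessellation incident both to a cell in $A_n$ and to a cell in $\mathcal L\cap[-n,n]^3$) to a vertex on the exterior boundary of $A_n$ (a vertex incident both to a cell in $A_n$ and to a cell in $\mathcal L\setminus[-3n,3n]^3$). A vector $p\in\mathcal T$ lies in the extended phase if $\mathbb P_p(E_n)$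 is bounded below by a positive constant independent of $n$. *)

(* Defs.v *)
From HB Require Import structures.
From mathcomp Require Import all_boot all_order all_algebra finmap.
From mathcomp Require Import all_classical all_reals all_analysis.

Set Implicit Arguments.
Unset Strict Implicit.
Unset Printing Implicit Defensive.

Import Order.TTheory GRing.Theory Num.Theory.
Import numFieldTopology.Exports numFieldNormedType.Exports.

Local Open Scope classical_set_scope.
Local Open Scope ring_scope.

(* The library has no infinite product of probability measures.  We build the
   law of an i.i.d. family (x i)_{i : I} of 'I_k.+1-valued variables, I
   countable, as the Caratheodory extension of its values on cylinders; it is
   characterized by iid_law_cylinder below. *)

Definition iid_space (I : countType) (k : nat) : Type := I -> 'I_k.+1.

HB.instance Definition _ (I : countType) (k : nat) :=
  gen_eqMixin (iid_space I k).

HB.instance Definition _ (I : countType) (k : nat) :=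
  gen_choiceMixin (iid_space I k).

HB.instance Definition _ (I : countType) (k : nat) :=
  isPointed.Build (iid_space I k) (fun=> ord0).

Section cylinders.
Context {I : countType} {k : nat}.
Local Notation Omega := (iid_space I k).
Implicit Types (A B : set Omega) (x y : Omega) (i : I).

(* The index of a coordinate; finmap shadows the name pickle. *)
Definition idx (i : I) : nat := choice.pickle i.

Lemma idx_inj : injective idx.
Proof. exact: pcan_inj choice.pickleK. Qed.

Definition agree (n : nat) x y := forall i, (idx i < n)%N -> x i = y i.

Definition determined (n : nat) A := forall x y, agree n x y -> A x -> A y.

Definition cylinder : set (set Omega) :=
  [set A | exists n, determined n A].

Lemma agreeC n x y : agree n x y -> agree n y x.
Proof. by move=> xy i /xy. Qed.

Lemma agree_trans n y x z : agree n x y -> agree n y z -> agree n x z.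
Proof. by move=> xy yz i ni; rewrite xy// yz. Qed.

Lemma agree_le m n x y : (m <= n)%N -> agree n x y -> agree m x y.
Proof. by move=> mn xy i im; apply: xy; exact: leq_trans mn. Qed.

Lemma determined_le m n A : (m <= n)%N -> determined m A -> determined n A.
Proof. by move=> mn mA x y /(agree_le mn); exact: mA. Qed.

Lemma determinedC n A : determined n A -> determined n (~` A).
Proof. by move=> nA x y xy nAx Ay; apply: nAx; exact: nA (agreeC xy) Ay. Qed.

Lemma determinedU n A B :
  determined n A -> determined n B -> determined n (A `|` B).
Proof.
by move=> nA nB x y xy [Ax|Bx]; [left; exact: nA Ax|right; exact: nB Bx].
Qed.

Lemma cylinder0 : cylinder set0.
Proof. by exists 0%N. Qed.

Lemma cylinderC A : cylinder A -> cylinder (~` A).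
Proof. by move=> [n /determinedC ?]; exists n. Qed.

Lemma cylinderU A B : cylinder A -> cylinder B -> cylinder (A `|` B).
Proof.
move=> [m mA] [n nB]; exists (maxn m n).
by apply: determinedU; [apply: determined_le mA|apply: determined_le nB];
  rewrite leq_max leqnn ?orbT.
Qed.

Definition update (n : nat) (c : 'I_k.+1) x : Omega :=
  fun i => if idx i == n then c else x i.

Lemma agree_update n c x : agree n (update n c x) x.
Proof. by move=> i ni; rewrite /update ltn_eqF. Qed.

Lemma agree_updateS n c x y :
  agree n x y -> agree n.+1 (update n c x) (update n c y).
Proof.
move=> xy i; rewrite ltnS leq_eqVlt /update.
by case: eqVneq => //= _ /xy.
Qed.

Lemma agree_updateE n x y :
  agree n x y -> exists c, agree n.+1 (update n c x) y.
Proof.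
move=> xy; have [[i ni]|Nn] := pselect (exists i : I, idx i = n).
  exists (y i) => j; rewrite ltnS leq_eqVlt /update.
  have [jn|_ /= jn] := eqVneq (idx j) n; last exact: xy.
  by rewrite (_ : i = j)//; apply: idx_inj; rewrite ni jn.
exists ord0 => j; rewrite ltnS leq_eqVlt /update.
have [jn|_ /= jn] := eqVneq (idx j) n; last exact: xy.
by exfalso; apply: Nn; exists j.
Qed.

(* Compactness, in the form of Koenig's lemma. *)
Lemma cylinder_compact (C : (set Omega)^nat) :
  (forall n, cylinder (C n)) -> (forall m n, (m <= n)%N -> C n `<=` C m) ->
  \bigcap_n C n = set0 -> exists n, C n = set0.
Proof.
move=> cC dC C0; apply: contrapT => /forallNP Cn0.
pose good n x := forall m, exists2 y, C m y & agree n x y.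
have step n x : exists c, good n x -> good n.+1 (update n c x).
  apply: contrapT => /forallNP bad.
  have good_x : good n x by have /not_implyP[] := bad ord0.
  have /choice[f fP] (c : 'I_k.+1) : exists m,
      ~ exists2 y, C m y & agree n.+1 (update n c x) y.
    by have /not_implyP[_ /existsNP] := bad c.
  have [y Cy xy] := good_x (\max_c f c)%N.
  have [c cP] := agree_updateE xy.
  by apply: (fP c); exists y => //; apply: dC Cy; exact: leq_bigmax.
pose f n x := projT1 (cid (step n x)).
pose fix X (n : nat) : Omega :=
  if n is m.+1 then update m (f m (X m)) (X m) else point.
have goodX n : good n (X n).
  elim: n => [m|n]; last exact: projT2 (cid (step n (X n))).
  have [y Cy] : C m !=set0 by apply/set0P/eqP; exact: Cn0.
  by exists y.
have XE n m : (n <= m)%N -> agree n (X m) (X n).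
  elim: m => [|m IH]; first by rewrite leqn0 => /eqP->.
  rewrite leq_eqVlt => /predU1P[->//|]; rewrite ltnS => nm.
  by apply: agree_trans (IH nm); apply: agree_le nm _; exact: agree_update.
pose z : Omega := fun i => X (idx i).+1 i.
suff : (\bigcap_n C n) z by rewrite C0.
move=> m _; have [n nC] := cC m; have [y Cy Xy] := goodX n m.
apply: nC Cy; apply: agree_trans (agreeC Xy) _ => i ni.
by rewrite /z (XE (idx i).+1 n)//.
Qed.

End cylinders.

Fact cylinder_display : measure_display.
Proof. exact: default_measure_display. Qed.

HB.instance Definition _ (I : countType) (k : nat) :=
  @isAlgebraOfSets.Build cylinder_display (iid_space I k) cylinder
    cylinder0 cylinderU cylinderC.

Definition simplex (R : realType) (n : nat) : set 'rV[R]_n :=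
  [set p | (forall i, 0 <= p ord0 i <= 1) /\ \sum_i p ord0 i = 1].

Arguments simplex : clear implicits.

Section iid_content.
Context {R : realType} {I : countType} {k : nat}.
Local Notation Omega := (iid_space I k).
Implicit Types (A B : set Omega) (x y : Omega) (g h : Omega -> R).
Variable p : simplex R k.+1.
Let q c : R := (\val p) ord0 c.

Let q_ge0 c : 0 <= q c.
Proof. by have /set_mem[/(_ c)/andP[]] := valP p. Qed.

Let q_sum1 : \sum_c q c = 1.
Proof. by have /set_mem[] := valP p. Qed.

(* Integrates out the coordinates of index less than n. *)
Fixpoint avg (n : nat) g : Omega -> R :=
  if n is m.+1 then avg m (fun x => \sum_c q c * g (update m c x)) else g.

Definition depends (n : nat) g := forall x y, agree n x y -> g x = g y.

Lemma depends_indic n A : determined n A -> depends n (\1_A).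
Proof.
move=> nA x y xy; rewrite !indicE; congr (_%:R); congr nat_of_bool.
by apply/idP/idP; rewrite !inE; apply: nA => //; exact: agreeC.
Qed.

Lemma avg_ge0 n g x : (forall y, 0 <= g y) -> 0 <= avg n g x.
Proof.
elim: n g => [|n IH] g g0 //=; apply: IH => y.
by apply: sumr_ge0 => c _; rewrite mulr_ge0.
Qed.

Lemma avg_cst n (r : R) x : avg n (cst r) x = r.
Proof.
elim: n => //= n; rewrite (_ : (fun _ => _) = cst r)//.
by apply/funext => y /=; rewrite -mulr_suml q_sum1 mul1r.
Qed.

Lemma avgD n g h x : avg n (fun y => g y + h y) x = avg n g x + avg n h x.
Proof.
elim: n g h => //= n IH g h; rewrite -IH; congr (avg n _ x).
by apply/funext => y; rewrite -big_split; apply: eq_bigr => c _; rewrite mulrDr.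
Qed.

Lemma avg_const n g x y : depends n g -> avg n g x = avg n g y.
Proof.
elim: n g => [|n IH] g ng /=; first exact: ng.
apply: IH => {}x {}y xy; apply: eq_bigr => c _; congr (_ * _).
by apply: ng; exact: agree_updateS.
Qed.

Lemma avg_le m n g : (m <= n)%N -> depends m g -> avg n g = avg m g.
Proof.
move=> + mg; elim: n => [|n IH]; first by rewrite leqn0 => /eqP->.
rewrite leq_eqVlt => /predU1P[->//|]; rewrite ltnS => mn /=.
rewrite -IH//; congr (avg n _); apply/funext => x.
rewrite (eq_bigr (fun c => q c * g x)) => [|c _].
  by rewrite -mulr_suml q_sum1 mul1r.
by congr (_ * _); apply: mg; apply: agree_le mn _; exact: agree_update.
Qed.

Definition iid_content A : \bar R :=
  (avg (xget 0%N [set n | determined n A]) \1_A point)%:E.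

Lemma iid_contentE n A x : determined n A -> iid_content A = (avg n \1_A x)%:E.
Proof.
move=> nA; rewrite /iid_content; case: xgetP => [m _ mA|/(_ n)]//.
congr (_%:E); rewrite (avg_const point x (depends_indic mA)).
have [mn|/ltnW nm] := leqP m n.
  by rewrite -(avg_le mn (depends_indic mA)).
by rewrite (avg_le nm (depends_indic nA)).
Qed.

Lemma iid_content_ge0 A : (0 <= iid_content A)%E.
Proof. by rewrite lee_fin; apply: avg_ge0 => y; rewrite indicE. Qed.

Lemma iid_content0 : iid_content set0 = 0%E.
Proof.
by rewrite (@iid_contentE 0 _ point)//= indicE in_set0.
Qed.

Lemma iid_contentU A B : cylinder A -> cylinder B -> A `&` B = set0 ->
  iid_content (A `|` B) = (iid_content A + iid_content B)%E.
Proof.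
move=> [m mA] [n nB] AB0; pose N := maxn m n.
have NA : determined N A by apply: determined_le mA; exact: leq_maxl.
have NB : determined N B by apply: determined_le nB; exact: leq_maxr.
rewrite (iid_contentE point NA) (iid_contentE point NB).
rewrite (iid_contentE point (determinedU NA NB)) -EFinD -avgD.
congr (avg N _ point)%:E; apply/funext => x; rewrite !indicE in_setU.
have : ~ (A `&` B) x by rewrite AB0.
have [/set_mem Ax|_] := boolP (x \in A); last by rewrite add0r.
have [/set_mem Bx nAB|_ _] := boolP (x \in B); last by rewrite addr0.
by exfalso; apply: nAB.
Qed.

Lemma iid_content_sigma_additive :
  semi_sigma_additive (iid_content : set Omega -> \bar R).
Proof.
move=> B mB tB mU; set U := \bigcup_n B n.
pose S n := \big[setU/set0]_(i < n) B i.
have cS n : cylinder (S n).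
  apply: (@big_ind _ cylinder) => [||i _]; first exact: cylinder0.
    exact: cylinderU.
  exact: mB.
have SE n : (\sum_(0 <= i < n) iid_content (B i))%E = iid_content (S n).
  elim: n => [|n IH]; first by rewrite /S big_geq// big_ord0 iid_content0.
  rewrite big_nat_recr//= IH /S big_ord_recr/= iid_contentU//.
  - exact: cS.
  - exact: mB.
  rewrite -subset0 => x [].
  rewrite -bigcup_mkord => -[i /= i_lt_n Bix] Bnx.
  by move: i_lt_n; rewrite (tB i n Logic.I Logic.I)//; [rewrite ltnn|exists x].
have [N UN] : exists N, U `\` S N = set0.
  apply: (@cylinder_compact _ _ (fun n => U `\` S n)).
  - move=> n; rewrite setDE -[U]setCK -setCU.
    by apply: cylinderC; apply: cylinderU => //; exact: cylinderC.
  - move=> m n mn x [Ux nSx]; split=> //; apply: contra_not nSx.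
    rewrite /S -!bigcup_mkord => -[i /= im Bi].
    by exists i => //=; exact: leq_trans mn.
  - rewrite -subset0 => x Cx; have [[i _ Bi] _] := Cx 0%N Logic.I.
    have [_] := Cx i.+1 Logic.I; apply; rewrite /S -bigcup_mkord.
    by exists i => //=.
have US n : (N <= n)%N -> S n = U.
  move=> Nn; apply/seteqP; split=> x.
    by rewrite /S -bigcup_mkord => -[i _ Bi]; exists i.
  move=> Ux; have : ~ (U `\` S N) x by rewrite UN.
  move=> /not_andP[//|/contrapT].
  rewrite /S -!bigcup_mkord => -[i /= iN Bi].
  by exists i => //=; exact: leq_trans Nn.
apply: cvg_near_cst; exists N => // n /= Nn.
by rewrite SE US.
Qed.

HB.instance Definition _ :=
  isMeasure.Build cylinder_display Omega R iid_content
    iid_content0 iid_content_ge0 iid_content_sigma_additive.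

Lemma iid_contentT : iid_content setT = 1%E.
Proof.
by rewrite (@iid_contentE 0 _ point)//= indicE in_setT.
Qed.

Lemma avg_prod n (s : seq I) (h : I -> 'I_k.+1 -> R) x : uniq s ->
  avg n (fun y => \prod_(i <- s) h i (y i)) x =
  \prod_(i <- s) if (idx i < n)%N then \sum_c q c * h i c else h i (x i).
Proof.
move=> us; elim: n h => [//|n IH] h /=.
pose h' i d := if idx i == n then \sum_c q c * h i c else h i d.
rewrite (_ : (fun _ => _) = fun y => \prod_(i <- s) h' i (y i)); last first.
  apply/funext => y; have [[j js jn]|Nn] := pselect (exists2 j, j \in s & idx j = n).
    have jP i : i != j -> (idx i == n) = false.
      by apply: contra_neqF => /eqP; rewrite -jn => /idx_inj.
    rewrite [RHS](bigD1_seq j)//= {1}/h' jn eqxx mulr_suml; apply: eq_bigr => c _.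
    rewrite (bigD1_seq j)//= /update jn eqxx mulrA; congr (_ * _).
    by apply: eq_bigr => i /jP ij; rewrite /h' ij.
  rewrite [RHS](eq_big_seq (fun i => h i (y i))) => [|i si]; last first.
    by rewrite /h'; case: eqP => // in'; exfalso; apply: Nn; exists i.
  rewrite -[RHS]mul1r -q_sum1 mulr_suml; apply: eq_bigr => c _; congr (_ * _).
  apply: eq_big_seq => i si; rewrite /update.
  by case: eqP => // in'; exfalso; apply: Nn; exists i.
rewrite IH; apply: eq_bigr => i _; rewrite [in RHS]ltnS [in RHS]leq_eqVlt /h'.
by have [->|_] := eqVneq (idx i) n; rewrite /= ?ltnn.
Qed.

Lemma determined_fix (s : seq I) (a : I -> 'I_k.+1) :
  determined (\max_(i <- s) (idx i).+1)%N
    [set x : Omega | forall i, i \in s -> x i = a i].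
Proof.
move=> x y xy xa i si; rewrite -xy ?xa//.
by rewrite (big_rem i)//= leq_max ltnSn.
Qed.

Lemma iid_content_cylinder (s : seq I) (a : I -> 'I_k.+1) : uniq s ->
  iid_content [set x | forall i, i \in s -> x i = a i] =
  (\prod_(i <- s) (\val p) ord0 (a i))%:E.
Proof.
move=> us; pose n := (\max_(i <- s) (idx i).+1)%N.
have sn i : i \in s -> (idx i < n)%N.
  by move=> si; rewrite /n (big_rem i)//= leq_max ltnSn.
rewrite (@iid_contentE n _ point); last exact: determined_fix.
congr (_%:E); transitivity
    (avg n (fun y => \prod_(i <- s) (y i == a i)%:R) point).
  congr (avg n _ point); apply/funext => y; rewrite indicE.
  have [/set_mem /= ya|] := boolP (_ \in _).
    by rewrite big_seq big1// => i /ya ->; rewrite eqxx.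
  move=> /negP ya; apply/esym/eqP; rewrite prodf_seq_eq0.
  apply: contraT => /hasPn ha; exfalso; apply: ya.
  rewrite inE => i si; have /= := ha i si.
  by rewrite pnatr_eq0 eqb0 negbK => /eqP.
rewrite (avg_prod n (fun i d => (d == a i)%:R))//; apply: eq_big_seq => i /sn ->.
rewrite (bigD1 (a i))//= eqxx mulr1 big1 ?addr0// => c /negbTE ->.
by rewrite mulr0.
Qed.

End iid_content.

Definition iid_law (R : realType) (I : countType) (k : nat)
    (p : simplex R k.+1) :
    set (g_sigma_algebraType (@measurable _ (iid_space I k))) -> \bar R :=
  measure_extension (iid_content p).

HB.instance Definition _ (R : realType) (I : countType) (k : nat)
    (p : simplex R k.+1) :=
  Measure.on (@iid_law R I k p).

Lemma iid_lawT (R : realType) (I : countType) (k : nat) (p : simplex R k.+1) :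
  @iid_law R I k p setT = 1%E.
Proof.
rewrite /iid_law/= /measure_extension measurable_mu_extE/=.
  exact: iid_contentT.
exact: measurableT.
Qed.

HB.instance Definition _ (R : realType) (I : countType) (k : nat)
    (p : simplex R k.+1) :=
  @Measure_isProbability.Build _ _ R (@iid_law R I k p) (@iid_lawT R I k p).

Lemma iid_law_cylinder (R : realType) (I : countType) (k : nat)
    (p : simplex R k.+1) (s : seq I) (a : I -> 'I_k.+1) : uniq s ->
  iid_law p [set x : iid_space I k | forall i, i \in s -> x i = a i] =
  (\prod_(i <- s) (\val p) ord0 (a i))%:E.
Proof.
move=> us; rewrite /iid_law/= /measure_extension measurable_mu_extE/=.
  exact: iid_content_cylinder.
by exists (\max_(i <- s) (idx i).+1)%N; exact: determined_fix.
Qed.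

(* The body-centred cubic lattice 2Z^3 + {0, (1, 1, 1)}. *)
Definition in_lattice (v : 'rV[int]_3) : bool :=
  [forall i, (2 %| v ord0 i)%Z] || [forall i, (2 %| v ord0 i - 1)%Z].

Definition cell : Type := {v : 'rV[int]_3 | in_lattice v}.

HB.instance Definition _ := Countable.on cell.

Definition adjacent_cells (v w : cell) : bool :=
  let d := \val v - \val w in
  [exists i : 'I_3, (d == delta_mx ord0 i *+ 2) || (d == - delta_mx ord0 i *+ 2)]
  || [forall i, (d ord0 i == 1) || (d ord0 i == - 1)].

Definition mutually_adjacent (s : {fset cell}) : Prop :=
  forall v w, v \in s -> w \in s -> v != w -> adjacent_cells v w.

(* Edges and vertices of the tessellation are identified with the sets of
   cells incident to them. *)
Definition is_edge (e : {fset cell}) : Prop :=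
  #|` e| = 3%N /\ mutually_adjacent e.

Definition is_vertex (x : {fset cell}) : Prop :=
  #|` x| = 4%N /\ mutually_adjacent x.

(* The colors red, yellow, blue are 0, 1, 2. *)
Definition coloring : Type := iid_space cell 2.

Definition coloring_law (R : realType) (p : simplex R 3) :
    probability (g_sigma_algebraType (@measurable _ (iid_space cell 2))) R :=
  iid_law p.

Definition tricolor_edge (c : coloring) (e : {fset cell}) : Prop :=
  is_edge e /\ {in e &, injective c}.

Definition tricolor_step (c : coloring) (x y : {fset cell}) : Prop :=
  [/\ is_vertex x, is_vertex y, x != y &
    exists e, [/\ tricolor_edge c e, (e `<=` x)%fset & (e `<=` y)%fset]].

Definition tricolor_path (c : coloring) (x : {fset cell})
    (s : seq {fset cell}) : bool :=
  path (fun y z => `[< tricolor_step c y z >]) x s.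

(* v \in [-m, m]^3 *)
Definition in_box (m : nat) (v : cell) : bool :=
  [forall i, `|(\val v) ord0 i| <= m%:Z].

Definition annulus (n : nat) (v : cell) : bool :=
  in_box (3 * n) v && ~~ in_box n v.

Definition interior_boundary (n : nat) (x : {fset cell}) : Prop :=
  [/\ is_vertex x, exists2 v, v \in x & annulus n v &
    exists2 v, v \in x & in_box n v].

Definition exterior_boundary (n : nat) (x : {fset cell}) : Prop :=
  [/\ is_vertex x, exists2 v, v \in x & annulus n v &
    exists2 v, v \in x & ~~ in_box (3 * n) v].

Definition crossing (n : nat) : set coloring :=
  [set c | exists x s, [/\ interior_boundary n x,
    exterior_boundary n (last x s) & tricolor_path c x s]].

Lemma tricolor_step_agree n (c d : coloring) (x y : {fset cell}) :
  (forall v, v \in x -> idx v < n)%N -> agree n c d ->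
  tricolor_step c x y -> tricolor_step d x y.
Proof.
move=> xn cd [vx vy xy [e [[ee ec] /fsubsetP ex ey]]]; split => //.
exists e; split => //; last exact/fsubsetP.
split=> // v w ve we; rewrite -!cd; first exact: ec.
- exact/xn/ex.
- exact/xn/ex.
Qed.

Lemma tricolor_path_cylinder (x : {fset cell}) (s : seq {fset cell}) :
  cylinder ([set c | tricolor_path c x s] : set coloring).
Proof.
elim: s x => [|y s IH] x; first by exists 0%N.
have [n nP] := IH y.
pose m := (\max_(v <- x) (idx v).+1)%N.
have xm v : v \in x -> (idx v < m)%N.
  by move=> vx; rewrite /m (big_rem v)//= leq_max ltnSn.
exists (maxn m n) => c d cd /= /andP[/asboolP st pt].
rewrite /tricolor_path /=; apply/andP; split.
  apply/asboolP; apply: tricolor_step_agree st; first exact: xm.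
  by apply: agree_le cd; exact: leq_maxl.
by apply: nP pt; apply: agree_le cd; exact: leq_maxr.
Qed.

Lemma measurable_crossing n :
  measurable (crossing n :
    set (g_sigma_algebraType (@measurable _ (iid_space cell 2)))).
Proof.
pose B (u : {fset cell} * seq {fset cell}) : set (iid_space cell 2) :=
  [set c | [/\ interior_boundary n u.1, exterior_boundary n (last u.1 u.2)
    & tricolor_path c u.1 u.2]].
rewrite (_ : crossing n = \bigcup_u B u); last first.
  apply/seteqP; split=> [c [x [s Hc]]|c [[x s] _ Hc]]; first by exists (x, s).
  by exists x, s.
apply: countable_bigcupT_measurable => // u.
apply: sub_sigma_algebra; have [m mP] := tricolor_path_cylinder u.1 u.2.
by exists m => c d cd [i e t]; split => //; exact: mP t.
Qed.

Definition extended_phase (R : realType) : set (simplex R 3) :=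
  [set p | exists2 r : R, 0 < r &
    forall n, (0 < n)%N -> (r%:E <= coloring_law p (crossing n))%E].

(* Main.v *)
Require Import Defs.
From mathcomp Require Import all_boot all_order all_algebra finmap.
From mathcomp Require Import all_classical all_reals all_analysis.
From mathcomp Require Import zify ring lra.

(* Closedness.  A crossing at scale m in [6n, 36n] starts and ends near two
   crossings at scale n whose positions are among boundedly many and which
   depend on disjoint sets of cells, so P(E_m) <= C P(E_n)^2, also when the
   marginals vary in space.  Hence if P(E_n) < 1/(2C) for a single n, then
   P(E_(6^i n)) decays, and the extended phase is
   {p | P_p(E_n) >= 1/(2C) for all n}; P_p(E_n) is a polynomial in p.

   Non-emptiness.  Otherwise, by compactness, P_p(E_n) <= 1/(4C) for some n and
   all p.  Color the cells independently with a slowly varying probability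
   vector, depending on two of the three coordinates, that maps a square of
   large side m to the whole simplex as in Sperner's lemma; crossings at scale m
   are then unlikely.  But modulo 2 the tricolor triangles of the Delaunay
   triangulation form a cocycle with odd flux through the square and none
   through the sides of the prism above it, so a tricolor path joins the bottom
   of the prism to its top, whatever its height. *)

Set Implicit Arguments.
Unset Strict Implicit.
Unset Printing Implicit Defensive.

Import Order.TTheory GRing.Theory Num.Theory.
Import numFieldTopology.Exports numFieldNormedType.Exports.

Local Open Scope classical_set_scope.
Local Open Scope ring_scope.

(** * Product laws with varying marginals *)

Section mean.
Context {R : realType} {I : countType} {k : nat}.
Local Notation Omega := (iid_space I k).
Implicit Types (x y : Omega) (g h : Omega -> R) (s t : seq I).
Implicit Types (q : I -> 'I_k.+1 -> R).

Definition probs q := forall i, (forall c, 0 <= q i c) /\ \sum_c q i c = 1.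

Definition set_at i (c : 'I_k.+1) x : Omega :=
  fun j => if j == i then c else x j.

(** The expectation over independent coordinates in [s], the others being read from the argument. In
    contrast to [avg], the marginals may vary with the coordinate and [s] is any finite list. *)
Fixpoint mean q s g : Omega -> R :=
  if s is i :: s' then fun x => \sum_c q i c * mean q s' g (set_at i c x)
  else g.

Definition depends_on s g := forall x y, {in s, x =1 y} -> g x = g y.

Lemma set_atC i j c d x : i != j ->
  set_at i c (set_at j d x) = set_at j d (set_at i c x).
Proof.
move=> ij; apply/funext => l; rewrite /set_at.
by case: eqVneq => // ->; rewrite (negbTE ij).
Qed.

Lemma mean_cat q s t g : mean q (s ++ t) g = mean q s (mean q t g).
Proof.
elim: s => [|i s IH] //=; apply/funext => x.
by apply: eq_bigr => c _; rewrite IH.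
Qed.

Lemma mean_depends_on q s t g : depends_on s g -> depends_on s (mean q t g).
Proof.
move=> sg; elim: t => [|i t IH] //= x y xy; apply: eq_bigr => c _.
by congr (_ * _); apply: IH => j js; rewrite /set_at; case: eqP => // _; exact: xy.
Qed.

(** Fubini for finite sums: the last entry of [t] is moved to the end of [s] by exchanging sums one
    at a time. *)
Lemma mean_perm q s t g : perm_eq s t -> uniq s -> mean q s g = mean q t g.
Proof.
elim/last_ind: t s g => [|t i IH] s g st us.
  by move/perm_nilP: st => ->.
have : i \in s by rewrite (perm_mem st) mem_rcons mem_head.
move=> /splitPr si; case: si st us => s1 s2 st us.
have st' : perm_eq (s1 ++ s2) t.
  apply/permP => P; have := permP st P.
  by rewrite -cats1 !count_cat /=; lia.
rewrite -cats1 [RHS]mean_cat -(IH _ _ st'); last first.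
  by move: us; rewrite !cat_uniq /= negb_or => /and3P[-> /andP[_ ->] /andP[_ ->]].
rewrite !mean_cat /=; congr (mean q s1 _).
have {us} : i \notin s2 by move: us; rewrite cat_uniq /= => /and3P[_ _ /andP[]].
elim: s2 {st st'} => [//|j s2 IH2] /=; rewrite inE negb_or => /andP[ij /IH2 {}IH2].
apply/funext => x.
under eq_bigr do rewrite mulr_sumr.
rewrite exchange_big; apply: eq_bigr => c _ /=.
rewrite -IH2 mulr_sumr; apply: eq_bigr => d _.
by rewrite mulrCA set_atC// eq_sym.
Qed.

Lemma mean_indep_set q s t g x : probs q -> depends_on s g ->
  (forall i, i \in t -> i \notin s) -> mean q t g x = g x.
Proof.
move=> pq sg; elim: t x => [//|i t IH] x ts /=.
rewrite -[RHS]mul1r -(pq i).2 mulr_suml; apply: eq_bigr => c _.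
congr (_ * _); rewrite IH => [|j jt]; last by apply: ts; rewrite inE jt orbT.
apply: sg => j js; rewrite /set_at; case: eqP => // ji.
by have := ts i (mem_head _ _); rewrite -ji js.
Qed.

Lemma mean_widen q s t g x : probs q -> uniq s -> uniq t ->
  {subset s <= t} -> depends_on s g -> mean q t g x = mean q s g x.
Proof.
move=> pq us ut st sg.
rewrite (mean_perm (t := s ++ [seq i <- t | i \notin s]) _ _ _ ut); last first.
  apply: uniq_perm => //.
    rewrite cat_uniq us filter_uniq// andbT /=.
    by apply/hasPn => i; rewrite mem_filter => /andP[].
  move=> i; rewrite mem_cat mem_filter.
  by case: (boolP (i \in s)) => //= /st ->.
rewrite mean_cat; congr (mean q s _ x); apply/funext => y.
by apply: mean_indep_set sg _ => // i; rewrite mem_filter => /andP[].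
Qed.

Lemma mean_const q s g x y : depends_on s g ->
  mean q s g x = mean q s g y.
Proof.
(* Generalized for the induction: [r] collects the coordinates already set to a common value. *)
suff H (r : seq I) :
    (forall a b : Omega, {in r, a =1 b} -> {in s, a =1 b} -> g a = g b) ->
    forall a b : Omega, {in r, a =1 b} -> mean q s g a = mean q s g b.
  move=> sg; apply: (H [::]) => // a b _; exact: sg.
elim: s r => [|i s IH] r H a b ab /=; first by apply: H.
apply: eq_bigr => c _; congr (_ * _); apply: (IH (i :: r)) => [u v uv uv'|j].
  apply: H => j; first by move=> jr; apply: uv; rewrite inE jr orbT.
  by rewrite inE => /predU1P[->|]; [apply: uv; rewrite mem_head|exact: uv'].
by rewrite inE /set_at; case: eqP => //= _ /ab.
Qed.

Lemma mean_le q s g h x : probs q -> (forall y, g y <= h y) ->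
  mean q s g x <= mean q s h x.
Proof.
move=> pq gh; elim: s x => [|i s IH] x //=; apply: ler_sum => c _.
by rewrite ler_wpM2l// (pq i).1.
Qed.

Lemma mean_cst q s (r : R) x : probs q -> mean q s (fun=> r) x = r.
Proof.
move=> pq; elim: s x => [|i s IH] x //=.
by under eq_bigr do rewrite IH; rewrite -mulr_suml (pq i).2 mul1r.
Qed.

Lemma mean_sum q s (J : Type) (r : seq J) (F : J -> Omega -> R) x :
  mean q s (fun y => \sum_(j <- r) F j y) x = \sum_(j <- r) mean q s (F j) x.
Proof.
elim: s x => [|i s IH] x //=.
under eq_bigr do rewrite IH mulr_sumr.
by rewrite exchange_big.
Qed.

(** Independence: integrating out one coordinate affects at most one of the two factors, the other
    being constant in it. *)
Lemma mean_mul q s t t' g h x : depends_on t g -> depends_on t' h ->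
  (forall i, i \in t -> i \notin t') -> probs q ->
  mean q s (fun y => g y * h y) x = mean q s g x * mean q s h x.
Proof.
move=> tg th tt' pq; elim/last_ind: s x g h tg th => [//|s i IH] x g h tg th.
rewrite -cats1 !mean_cat -IH; [|exact: mean_depends_on..].
congr (mean q s _ x); apply/funext => y /=.
have const (f : Omega -> R) r : depends_on r f -> i \notin r ->
    (forall c, f (set_at i c y) = f y) /\ \sum_c q i c * f (set_at i c y) = f y.
  move=> rf ir; have fE c : f (set_at i c y) = f y.
    by apply: rf => j jr; rewrite /set_at; case: eqP => // ji; rewrite -ji jr in ir.
  by split=> //; under eq_bigr do rewrite fE; rewrite -mulr_suml (pq i).2 mul1r.
have [it|it] := boolP (i \in t).
  have [hE ->] := const h t' th (tt' i it).
  by rewrite mulr_suml; apply: eq_bigr => c _; rewrite hE mulrA.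
have [gE ->] := const g t tg it.
by rewrite mulr_sumr; apply: eq_bigr => c _; rewrite gE mulrCA.
Qed.

Lemma mean_reindex q (f : I -> I) s g x : injective f ->
  mean q [seq f i | i <- s] (fun y => g (y \o f)) x =
  mean (q \o f) s g (x \o f).
Proof.
move=> fI; elim: s x => [//|i s IH] x /=; apply: eq_bigr => c _.
rewrite IH; congr (_ * mean _ _ _ _); apply/funext => j /=.
by rewrite /set_at /= (inj_eq fI).
Qed.

(** The marginals are switched one coordinate at a time; since [g] lies in [0, 1], each switch costs
    at most [e] for each of the [k.+1] values. *)
Lemma mean_dist q q' s g x (e : R) : probs q -> probs q' ->
  (forall y, 0 <= g y <= 1) ->
  (forall i c, i \in s -> `|q i c - q' i c| <= e) ->
  `|mean q s g x - mean q' s g x| <= ((size s) * k.+1)%:R * e.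
Proof.
move=> pq pq' g01; elim: s x => [|i s IH] x qq' /=.
  by rewrite subrr normr0 mul0n mul0r.
have -> : \sum_c q i c * mean q s g (set_at i c x) -
    \sum_c q' i c * mean q' s g (set_at i c x) =
    \sum_c (q i c - q' i c) * mean q s g (set_at i c x) +
    \sum_c q' i c * (mean q s g (set_at i c x) - mean q' s g (set_at i c x)).
  by rewrite -sumrB -big_split; apply: eq_bigr => c _ /=; ring.
rewrite mulSn natrD mulrDl (le_trans (ler_normD _ _))// lerD//.
  rewrite (le_trans (ler_norm_sum _ _ _))// -[in leRHS](card_ord k.+1) mulr_natl.
  rewrite -sumr_const; apply: ler_sum => c _; rewrite normrM.
  rewrite (le_trans _ (qq' i c (mem_head _ _)))// ler_piMr//.
  have m0 := @mean_le q s (fun=> 0) g (set_at i c x) pq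
    (fun y => proj1 (andP (g01 y))).
  have m1 := @mean_le q s g (fun=> 1) (set_at i c x) pq
    (fun y => proj2 (andP (g01 y))).
  by rewrite mean_cst// in m0; rewrite mean_cst// in m1; rewrite ger0_norm.
set C := (X in _ <= X); rewrite (le_trans (ler_norm_sum _ _ _))//.
rewrite -[leRHS]mul1r -(pq' i).2 mulr_suml {}/C.
apply: ler_sum => c _; rewrite normrM ger0_norm ?(pq' i).1// ler_wpM2l ?(pq' i).1//.
by apply: IH => j d js; apply: qq'; rewrite inE js orbT.
Qed.

(** Terms with a value of probability 0 vanish. The point [x] must avoid such values as well, since
    it supplies the coordinates outside [s]. *)
Lemma mean_positive q s g x : probs q -> (forall i, q i (x i) != 0) ->
  (forall y, (forall i, q i (y i) != 0) -> g y = 1) -> mean q s g x = 1.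
Proof.
move=> pq + g1; elim: s x => [|i s IH] x qx /=; first exact: g1.
rewrite -[RHS](pq i).2; apply: eq_bigr => c _.
have [->|qc] := eqVneq (q i c) 0; first by rewrite mul0r.
by rewrite IH ?mulr1// => j; rewrite /set_at; case: (j =P i) => [->|_].
Qed.

Lemma continuous_mean s g x :
  continuous (fun p : 'rV[R]_k.+1 => mean (fun=> p ord0) s g x).
Proof.
elim: s x => [|i s IH] x /=; first by move=> p; exact: cst_continuous.
elim: (index_enum _) => [|c r IHr].
  rewrite (_ : (fun _ => _) = fun=> 0); first by move=> p; exact: cst_continuous.
  by apply/funext => p; rewrite big_nil.
under eq_fun do rewrite big_cons.
move=> p; apply: (@continuousD R _ _ _ _ p); last exact: IHr.
apply: (@continuousM R _ _ _ p); last exact: IH.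
exact: coord_continuous.
Qed.

(** On an event with finite support the law is its content, an [avg] over all indices below [n].
    This is a [mean] over the list [L n] of elements with such an index, and indices that encode no
    element average trivially. *)
Lemma iid_law_mean (p : simplex R k.+1) s (A : set Omega) x : uniq s ->
  depends_on s (\1_A) ->
  iid_law p A = (mean (fun=> (\val p) ord0) s \1_A x)%:E.
Proof.
move=> us sA; pose n := (\max_(i <- s) (idx i).+1)%N.
have sn i : i \in s -> (idx i < n)%N.
  by move=> si; rewrite /n (big_rem i)//= leq_max ltnSn.
have nA : determined n A.
  move=> y z yz Ay; have : \1_A y = \1_A z :> R by apply: sA => i /sn; exact: yz.
  rewrite !indicE mem_set// => /eqP; have [/set_mem//|_] := boolP (z \in A).
  by rewrite oner_eq0.
rewrite /iid_law /= /measure_extension measurable_mu_extE /=; last by exists n.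
rewrite (iid_contentE _ x nA); congr (_%:E).
have pq : probs (fun _ : I => (\val p) ord0).
  move=> i; have /set_mem[p01 p1] := valP p.
  by split=> // c; have /andP[] := p01 c.
pose L m := pmap (@choice.pickle_inv I) (iota 0 m).
have LP m i : (i \in L m) = (idx i < m)%N.
  rewrite mem_pmap; apply/mapP/idP => [[j]|im].
    rewrite mem_iota add0n => /andP[_ jm] /esym ji.
    by have := @choice.pickle_invK I j; rewrite ji /= /idx => ->.
  by exists (idx i); rewrite ?mem_iota// choice.pickleK_inv.
have uL m : uniq (L m).
  apply: (pmap_uniq (@choice.pickle_invK I)); exact: iota_uniq.
have avgE m g : avg p m g x = mean (fun=> (\val p) ord0) (L m) g x.
  elim: m g => [//|m IH] g /=; rewrite IH /L.
  have -> : iota 0 m.+1 = iota 0 m ++ [:: m] by rewrite -addn1 iotaD.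
  rewrite pmap_cat mean_cat /=.
  congr (mean _ _ _ x); apply/funext => y.
  have := @choice.pickle_invK I m; rewrite /oapp /update /idx.
  case pm : choice.pickle_inv => [i|] /= => [im|_].
    apply: eq_bigr => c _; congr (_ * g _); apply/funext => j.
    rewrite /set_at -im; congr (if _ then _ else _).
    by rewrite (inj_eq (pcan_inj choice.pickleK)).
  under eq_bigr => c _.
    rewrite (_ : (fun i => _) = y); first over.
    apply/funext => i; case: eqP => // im.
    by move: pm; rewrite -im choice.pickleK_inv.
  have [i0|/forallNP noI] := pselect (exists i : I, True).
    by case: i0 => i _; rewrite -mulr_suml (pq i).2 mul1r.
  have /set_mem[_ p1] := valP p.
  by rewrite -mulr_suml p1 mul1r.
by rewrite avgE; apply: mean_widen => // i /sn; rewrite LP.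
Qed.

End mean.

(** * Lattice geometry and crossings *)

Local Notation co v i := ((\val (v : cell)) ord0 i).

Lemma in_latticeD u v : in_lattice u -> in_lattice v -> in_lattice (u + v).
Proof.
have E (a b : int) : (2 %| a)%Z -> (2 %| b)%Z -> (2 %| a + b)%Z.
  by move=> /dvdzP[a' ->] /dvdzP[b' ->]; rewrite -mulrDl dvdz_mull.
rewrite /in_lattice => /orP[/forallP u0|/forallP u1] /orP[/forallP v0|/forallP v1];
  apply/orP.
- by left; apply/forallP => i; rewrite mxE E.
- by right; apply/forallP => i; rewrite mxE -addrA E.
- by right; apply/forallP => i; rewrite mxE addrAC E.
- left; apply/forallP => i; rewrite mxE.
  have -> : u ord0 i + v ord0 i = (u ord0 i - 1) + (v ord0 i - 1) + 2 by ring.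
  by rewrite E// E.
Qed.

Lemma in_latticeN u : in_lattice u -> in_lattice (- u).
Proof.
rewrite /in_lattice => /orP[/forallP u0|/forallP u1]; apply/orP.
  by left; apply/forallP => i; rewrite mxE rpredN.
right; apply/forallP => i; rewrite mxE.
have -> : - u ord0 i - 1 = - (u ord0 i - 1) + (- 2) by ring.
by apply: rpredD; rewrite ?rpredN.
Qed.

Definition cell_add (t v : cell) : cell :=
  @exist _ in_lattice _ (in_latticeD (valP t) (valP v)).

Definition cell_opp (t : cell) : cell :=
  @exist _ in_lattice _ (in_latticeN (valP t)).

Lemma cell_addE t v i : co (cell_add t v) i = co t i + co v i.
Proof. by rewrite mxE. Qed.

Lemma cell_oppE t i : co (cell_opp t) i = - co t i.
Proof. by rewrite mxE. Qed.

Lemma cell_addK t : cancel (cell_add t) (cell_add (cell_opp t)).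
Proof. by move=> v; apply/val_inj; rewrite /= addKr. Qed.

Lemma cell_addNK t : cancel (cell_add (cell_opp t)) (cell_add t).
Proof. by move=> v; apply/val_inj; rewrite /= addNKr. Qed.

Lemma cell_add_inj t : injective (cell_add t).
Proof. exact: can_inj (cell_addK t). Qed.

Definition near_cells (m : nat) (u v : cell) : bool :=
  [forall i, `|co u i - co v i| <= m%:Z].

Lemma near_cellsP m u v :
  reflect (forall i, `|co u i - co v i| <= m%:Z) (near_cells m u v).
Proof. exact: forallP. Qed.

Lemma in_boxP m v : reflect (forall i, `|co v i| <= m%:Z) (in_box m v).
Proof. exact: forallP. Qed.

Lemma adjacent_near v w : adjacent_cells v w -> near_cells 2 v w.
Proof.
move=> /orP[/existsP[j vw]|/forallP vw]; apply/near_cellsP => i.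
  have -> : co v i - co w i = (\val v - \val w) ord0 i by rewrite !mxE.
  by case/orP: vw => /eqP ->; rewrite ?mulNrn !mxE; case: (_ && _).
by have := vw i; rewrite !mxE => /orP[] /eqP ->.
Qed.

Lemma adjacent_addl t v w :
  adjacent_cells (cell_add t v) (cell_add t w) = adjacent_cells v w.
Proof.
rewrite /adjacent_cells /=.
suff -> : \val t + \val v - (\val t + \val w) = \val v - \val w by [].
by rewrite opprD addrACA subrr add0r.
Qed.

Lemma vertex_near x v w : is_vertex x -> v \in x -> w \in x -> near_cells 2 v w.
Proof.
move=> [_ xa] vx wx; have [<-|/xa vw] := eqVneq v w.
  by apply/near_cellsP => i; rewrite subrr normr0.
by apply: adjacent_near; exact: vw.
Qed.

Lemma tricolor_step_common c x y : tricolor_step c x y ->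
  [/\ is_vertex x, is_vertex y & exists2 v, v \in x & v \in y].
Proof.
move=> [vx vy _ [e [[[e3 _] _] /fsubsetP ex /fsubsetP ey]]]; split=> //.
have : (0 < #|` e|)%N by rewrite e3.
by rewrite cardfs_gt0 => /fset0Pn[v ve]; exists v; [exact: ex|exact: ey].
Qed.

(** The prefix [s1] stops at the first vertex with a cell outside [B]. Consecutive vertices share a
    cell, so after a vertex whose cells all lie in [B] the next one still meets [B]. *)
Lemma path_exit (B : pred cell) c x s : is_vertex x -> tricolor_path c x s ->
  (exists2 v, v \in x & B v) -> (exists2 v, v \in last x s & ~~ B v) ->
  exists s1 s2, [/\ s = s1 ++ s2, is_vertex (last x s1),
    exists2 v, v \in last x s1 & ~~ B v &
    {in x :: s1, forall y, is_vertex y /\ exists2 v, v \in y & B v}].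
Proof.
elim: s x => [|y s IH] x vx /=.
  by move=> _ xB xNB; exists [::], [::]; split=> // y; rewrite inE => /eqP ->.
move=> /andP[/asboolP xy ys] xB lNB.
have [xNB|xNB] := pselect (exists2 v, v \in x & ~~ B v).
  exists [::], (y :: s); split=> // z; rewrite inE => /eqP -> //.
have [_ vy [v vx' vy']] := tricolor_step_common xy.
have Bv : B v by apply: contrapT => /negP Bv; apply: xNB; exists v.
have [s1 [s2 [-> vl lB ins]]] : exists s1 s2, [/\ s = s1 ++ s2,
    is_vertex (last y s1), exists2 v, v \in last y s1 & ~~ B v &
    {in y :: s1, forall y, is_vertex y /\ exists2 v, v \in y & B v}].
  by apply: IH => //; exists v.
exists (y :: s1), s2; split=> // z; rewrite inE => /predU1P[->//|]; exact: ins.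
Qed.

(** The crossing runs from the first exit from the box of radius n to the first exit, after that,
    from the box of radius 3n. *)
Lemma crossing_of_path n c x s : (0 < n)%N -> is_vertex x ->
  tricolor_path c x s -> (exists2 v, v \in x & in_box n v) ->
  (exists2 v, v \in last x s & ~~ in_box (3 * n) v) -> crossing n c.
Proof.
move=> n0 vx xs xn xN.
have sub v : in_box n v -> in_box (3 * n) v.
  by move=> /in_boxP vn; apply/in_boxP => i; have := vn i; lia.
(* The cells of a vertex are within distance 2, at most 2n, so no vertex meets both the inner box
   and the outside of the outer one. *)
have thick x' v w : is_vertex x' -> v \in x' -> w \in x' -> in_box n v ->
    ~~ in_box (3 * n) w -> False.
  move=> vx' vx'' wx' /in_boxP vn /negP; apply; apply/in_boxP => i.
  by have /near_cellsP/(_ i) := vertex_near vx' vx'' wx'; have := vn i; lia.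
have [] := @path_exit (in_box n) c x s vx xs xn.
  by case: xN => v vl vN; exists v => //; apply: contra vN; exact: sub.
move=> s1 [s2 [sE vl [w wl wn] ins]]; rewrite {}sE in xs xN.
move: xs; rewrite /tricolor_path cat_path => /andP[_ p2].
rewrite last_cat in xN.
set y := last x s1 in vl wl p2 xN.
have [_ [v vy vn]] : is_vertex y /\ exists2 v, v \in y & in_box n v.
  by apply: ins; exact: mem_last.
have wN : in_box (3 * n) w.
  by apply: contrapT => /negP; exact: (thick y v w).
have [] := @path_exit (in_box (3 * n)) c y s2 vl p2 _ xN.
  by exists v => //; exact: sub.
move=> t1 [t2 [s2E vl2 [u ul uN] ins2]].
exists y, t1; split.
- by split=> //; [exists w => //; rewrite /annulus wN|exists v].
- split=> //; last by exists u.
  have [_ [a al aN]] := ins2 _ (mem_last _ _).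
  exists a => //; rewrite /annulus aN /=; apply/negP => an.
  exact: (thick (last y t1) a u).
- by move: p2; rewrite s2E cat_path => /andP[].
Qed.

(** Cut at its first exit from the box of radius 3n, the path uses only vertices that meet this box,
    and their cells are within distance 2 of it. *)
Lemma crossing_local n (c d : coloring) : (0 < n)%N ->
  (forall v, in_box (3 * n + 2) v -> c v = d v) -> crossing n c -> crossing n d.
Proof.
move=> n0 cd [x [s [[vx _ [v vx' vn]] [vl _ [w wl wN]] xs]]].
have [] := @path_exit (in_box (3 * n)) c x s vx xs.
- by exists v => //; apply/in_boxP => i; have /in_boxP/(_ i) := vn; lia.
- by exists w.
move=> s1 [s2 [sE vl1 lN ins]].
apply: (@crossing_of_path n d x s1) => //; last by exists v.
move: xs; rewrite sE /tricolor_path cat_path => /andP[+ _].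
have {}ins : {in x :: s1, forall y, {in y, c =1 d}}.
  move=> y /ins[vy [a ay aN]] b yb; apply: cd; apply/in_boxP => i.
  by have /near_cellsP/(_ i) := vertex_near vy ay yb; have /in_boxP/(_ i) := aN; lia.
elim: s1 x {vx vx' vl wl sE vl1 lN} ins => [//|y s1 IH] x ins /=.
move=> /andP[/asboolP xy ys]; apply/andP; split; last first.
  by apply: IH => // z zs; apply: ins; rewrite inE zs orbT.
apply/asboolP; case: xy => vx vy xy [e [[ee ec] ex ey]]; split=> //.
exists e; split=> //; split=> // a b ae be.
by rewrite -!(ins x) ?mem_head ?(fsubsetP ex)//; exact: ec.
Qed.

(** * Translated crossings and comparison of scales *)

Definition shift_vertex (t : cell) (x : {fset cell}) : {fset cell} :=
  [fset cell_add t v | v in x]%fset.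

Lemma mem_shift_vertex t x v :
  (cell_add t v \in shift_vertex t x) = (v \in x).
Proof.
apply/imfsetP/idP => [[w /= wx /cell_add_inj ->//]|vx].
by exists v.
Qed.

Lemma card_shift_vertex t x : #|` shift_vertex t x| = #|` x|.
Proof. by rewrite card_imfset//; exact: cell_add_inj. Qed.

Lemma mutually_adjacent_shift t x :
  mutually_adjacent x -> mutually_adjacent (shift_vertex t x).
Proof.
move=> xa v w /imfsetP[v' /= vx ->] /imfsetP[w' /= wx ->].
by rewrite (inj_eq (@cell_add_inj t)) adjacent_addl; exact: xa.
Qed.

Lemma is_vertex_shift t x : is_vertex x -> is_vertex (shift_vertex t x).
Proof.
by move=> [x4 xa]; split; [rewrite card_shift_vertex|exact: mutually_adjacent_shift].
Qed.

Lemma tricolor_step_shift t (c d : coloring) x y :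
  (forall v, d (cell_add t v) = c v) ->
  tricolor_step c x y -> tricolor_step d (shift_vertex t x) (shift_vertex t y).
Proof.
move=> dc [vx vy xy [e [[[e3 ea] ec] ex ey]]].
have inj : injective (shift_vertex t).
  move=> u v uv; apply/fsetP => w.
  by rewrite -(mem_shift_vertex t) uv mem_shift_vertex.
have sub u v : (u `<=` v)%fset -> (shift_vertex t u `<=` shift_vertex t v)%fset.
  move=> /fsubsetP uv; apply/fsubsetP => _ /imfsetP[a /= au ->].
  by rewrite mem_shift_vertex; exact: uv.
split; [exact: is_vertex_shift|exact: is_vertex_shift|by rewrite (inj_eq inj)|].
exists (shift_vertex t e); split; [split|exact: sub|exact: sub].
  by split; [rewrite card_shift_vertex|exact: mutually_adjacent_shift].
move=> _ _ /imfsetP[a /= ae ->] /imfsetP[b /= be ->].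
by rewrite !dc => /ec ->.
Qed.

Lemma tricolor_path_shift t (c d : coloring) x s :
  (forall v, d (cell_add t v) = c v) -> tricolor_path c x s ->
  tricolor_path d (shift_vertex t x) (map (shift_vertex t) s).
Proof.
move=> dc; rewrite /tricolor_path; elim: s x => //= y s IH x.
move=> /andP[/asboolP xy ys]; rewrite IH// andbT.
by apply/asboolP; exact: tricolor_step_shift xy.
Qed.

Definition crossing_at (t : cell) (n : nat) : set coloring :=
  [set c : coloring | crossing n (fun v => c (cell_add t v))].

Lemma crossing_at_of_path t n c x s : (0 < n)%N -> is_vertex x ->
  tricolor_path c x s -> (exists2 v, v \in x & near_cells n v t) ->
  (exists2 v, v \in last x s & ~~ near_cells (3 * n) v t) -> crossing_at t n c.
Proof.
move=> n0 vx xs [v vx' vn] [w wl wn].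
have boxE m u : in_box m (cell_add (cell_opp t) u) = near_cells m u t.
  by apply: eq_forallb => i; rewrite cell_addE cell_oppE addrC.
apply: (@crossing_of_path n _ (shift_vertex (cell_opp t) x)
  (map (shift_vertex (cell_opp t)) s)) => //.
- exact: is_vertex_shift.
- by apply: tricolor_path_shift xs => u /=; rewrite cell_addNK.
- by exists (cell_add (cell_opp t) v); rewrite ?mem_shift_vertex ?boxE.
- exists (cell_add (cell_opp t) w); last by rewrite boxE.
  by rewrite last_map mem_shift_vertex.
Qed.

(* The index z i in [0, 120] stands for z i - 60 in [-60, 60]. *)
Definition grid_vec (m : nat) (z : {ffun 'I_3 -> 'I_121}) : 'rV[int]_3 :=
  \row_i (((z i)%:Z - 60) * m%:Z * 2).

Lemma in_lattice_grid m z : in_lattice (grid_vec m z).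
Proof. by apply/orP; left; apply/forallP => i; rewrite mxE dvdz_mull. Qed.

Definition grid (m : nat) (z : {ffun 'I_3 -> 'I_121}) : cell :=
  @exist _ in_lattice _ (in_lattice_grid m z).

Lemma gridE m z i : co (grid m z) i = ((z i)%:Z - 60) * m%:Z * 2.
Proof. by rewrite mxE. Qed.

Lemma near_grid m v : (0 < m)%N -> in_box (118 * m) v ->
  exists z, near_cells m v (grid m z).
Proof.
move=> m0 /in_boxP vm.
(* Rounding to the nearest multiple of 2m: the shift 121m is 60 steps of 2m, which recenter the
   index, plus m, which turns the floor into rounding. *)
pose k (i : 'I_3) : nat := (absz (co v i + (121 * m)%:Z)%R %/ (2 * m))%N.
have kP i : (k i < 121)%N /\ `|co v i - ((k i)%:Z - 60) * m%:Z * 2| <= m%:Z.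
  have := vm i; rewrite /k.
  set a := co v i => am.
  have [b ba] : exists b : nat, a + (121 * m)%:Z = b%:Z /\ a = b%:Z - (121 * m)%:Z.
    by exists (absz (a + (121 * m)%:Z)); lia.
  rewrite ba.1 absz_nat.
  have := divn_eq b (2 * m); have := @ltn_pmod b (2 * m).
  set q := (b %/ _)%N; set r := (b %% _)%N => rm bE.
  have {}rm : (r < 2 * m)%N by apply: rm; lia.
  split; first by rewrite ltnNge; apply/negP => q121; nia.
  case: ba => _ ->; nia.
exists [ffun i => Ordinal (kP i).1]; apply/near_cellsP => i.
by rewrite gridE ffunE; exact: (kP i).2.
Qed.

(** The ends of the path are more than 2m, hence 12n, apart in some coordinate, and each is within n
    of a grid point. The path therefore crosses around both grid points, and these are more than 10n
    apart, so beyond 6n + 4 = 2 (3n + 2): the two events depend on disjoint boxes. *)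
Lemma crossing_scale n m c : (0 < n)%N -> (6 * n <= m <= 36 * n)%N ->
  crossing m c -> exists z z' : {ffun 'I_3 -> 'I_121},
  [/\ crossing_at (grid n z) n c, crossing_at (grid n z') n c &
    ~~ near_cells (6 * n + 4) (grid n z) (grid n z')].
Proof.
move=> n0 /andP[nm mn] [x [s [[vx _ [u ux um]] [vl [a al aA] [w wl wm]] xs]]].
have [z uz] : exists z, near_cells n u (grid n z).
  by apply: near_grid => //; apply/in_boxP => i; have /in_boxP/(_ i) := um; lia.
have [z' wz] : exists z, near_cells n w (grid n z).
  apply: near_grid => //; apply/in_boxP => i.
  have /near_cellsP/(_ i) := vertex_near vl al wl.
  by have /andP[/in_boxP/(_ i) + _] := aA; lia.
have [i wi] : exists i, `|co w i| > (3 * m)%:Z.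
  by move: wm; rewrite negb_forall => /existsP[i]; rewrite -ltNge; exists i.
have /in_boxP/(_ i) ui := um.
have /near_cellsP/(_ i) uzi := uz; have /near_cellsP/(_ i) wzi := wz.
exists z, z'; split.
- apply: (@crossing_at_of_path _ _ _ x s) => //; first by exists u.
  exists w => //; apply/negP => /near_cellsP/(_ i) wn.
  by clear - nm ui uzi wi wn; lia.
(* The second crossing starts at the far end, so the path is reversed. *)
- have pathC y s' : tricolor_path c y s' ->
      exists s2, tricolor_path c (last y s') s2 /\ last (last y s') s2 = y.
    elim/last_ind: s' => [|s' z1 IH]; first by exists [::].
    rewrite /tricolor_path rcons_path => /andP[/IH[s2 [s2p s2l]] /asboolP st].
    exists (last y s' :: s2); rewrite last_rcons /=; split=> //.
    apply/andP; split=> //.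
    apply/asboolP; case: st => v1 v2 v12 [e [ec e1 e2]]; split=> //.
      by rewrite eq_sym.
    by exists e.
  have [s2 [s2p s2l]] := pathC _ _ xs.
  apply: (@crossing_at_of_path _ _ _ (last x s) s2) => //; first by exists w.
  rewrite s2l; exists u => //; apply/negP => /near_cellsP/(_ i) un.
  by clear - nm ui wi wzi un; lia.
- apply/negP => /near_cellsP/(_ i) zz.
  by clear - n0 nm ui wi uzi wzi zz; lia.
Qed.

(** * The flux of tricolor paths *)

Lemma adjacent_sym v w : adjacent_cells v w = adjacent_cells w v.
Proof.
suff H a b : adjacent_cells a b -> adjacent_cells b a by apply/idP/idP; exact: H.
rewrite /adjacent_cells -(opprB (\val a)) => /orP[/existsP[i ab]|/forallP ab];
  apply/orP; [left|right].
  apply/existsP; exists i; move: ab; rewrite mulNrn; move: (delta_mx _ _ *+ _) => e.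
  by rewrite eqr_opp eqr_oppLR orbC.
apply/forallP => i; have := ab i; set d := \val a - \val b.
rewrite (_ : (- d) ord0 i = - d ord0 i); last by rewrite mxE.
by rewrite eqr_opp eqr_oppLR orbC.
Qed.

Lemma adjacent_neq v w : adjacent_cells v w -> v != w.
Proof.
apply: contraL => /eqP ->; rewrite /adjacent_cells subrr negb_or; apply/andP; split.
  apply/negP => /existsP[i] /orP[] /eqP /rowP/(_ i); rewrite ?mulNrn !mxE !eqxx.
  - by [].
  - by [].
by apply/negP => /forallP/(_ ord0); rewrite mxE.
Qed.

Lemma in_fset4 (T : choiceType) (a b d e u : T) :
  (u \in [fset a; b; d; e]%fset) = [|| u == a, u == b, u == d | u == e].
Proof. by rewrite !in_fsetU !in_fset1 -!orbA. Qed.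

Lemma in_fset3 (T : choiceType) (a b d u : T) :
  (u \in [fset a; b; d]%fset) = [|| u == a, u == b | u == d].
Proof. by rewrite !in_fsetU !in_fset1 -!orbA. Qed.

Lemma cardfs3 (T : choiceType) (a b d : T) :
  uniq [:: a; b; d] -> #|` [fset a; b; d]%fset| = 3%N.
Proof.
rewrite /= !inE !negb_or -!andbA => /and3P[ab ad /andP[bd _]].
rewrite fsetUC cardfsU1 fsetUC cardfsU1 cardfs1 !in_fsetU !in_fset1.
by rewrite ![d == _]eq_sym (eq_sym b a) !negb_or ab ad bd.
Qed.

Lemma cardfs4 (T : choiceType) (a b d e : T) :
  uniq [:: a; b; d; e] -> #|` [fset a; b; d; e]%fset| = 4%N.
Proof.
rewrite /= !inE !negb_or -!andbA => /and4P[ab ad ae /and3P[bd be /andP[de _]]].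
rewrite fsetUC cardfsU1 fsetUC cardfsU1 fsetUC cardfsU1 cardfs1 !in_fsetU !in_fset1.
by rewrite ![d == _]eq_sym ![e == _]eq_sym !negb_or ab ad ae bd be de.
Qed.
Lemma quad_vertex a b d e :
  adjacent_cells a b -> adjacent_cells a d -> adjacent_cells a e ->
  adjacent_cells b d -> adjacent_cells b e -> adjacent_cells d e ->
  is_vertex [fset a; b; d; e]%fset.
Proof.
move=> ab ad ae bd be de. split.
 by apply: cardfs4; rewrite /= !inE !negb_or !adjacent_neq.
move=> v w. rewrite !in_fset4.
by move=> /or4P[] /eqP -> /or4P[] /eqP ->; rewrite ?eqxx// => _;
  rewrite // adjacent_sym.
Qed.

(* Coordinates in which the Delaunay triangulation of the body-centred cubic
   lattice becomes the Freudenthal triangulation of Z^3: unit steps are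
   (1, 1, 1), (1, -1, -1) and (-1, 1, -1). *)
Definition freudenthal_vec (i j k : nat) : 'rV[int]_3 :=
  \row_l [:: i%:Z + j%:Z - k%:Z; i%:Z - j%:Z + k%:Z; i%:Z - j%:Z - k%:Z]`_l.

Lemma ord3P (P : 'I_3 -> Prop) :
  P (inord 0) -> P (inord 1) -> P (inord 2) -> forall i, P i.
Proof.
move=> P0 P1 P2 [[|[|[|//]]] i3].
- by rewrite (_ : Ordinal i3 = inord 0)//; apply/val_inj; rewrite /= inordK.
- by rewrite (_ : Ordinal i3 = inord 1)//; apply/val_inj; rewrite /= inordK.
- by rewrite (_ : Ordinal i3 = inord 2)//; apply/val_inj; rewrite /= inordK.
Qed.

Lemma in_lattice_freudenthal i j k : in_lattice (freudenthal_vec i j k).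
Proof.
have [ev|od] := boolP (2 %| i%:Z + j%:Z + k%:Z)%Z; apply/orP; [left|right].
  by apply/forallP; apply: ord3P; rewrite mxE inordK//=; lia.
by apply/forallP; apply: ord3P; rewrite mxE inordK//=; lia.
Qed.

Definition fcell i j k : cell :=
  @exist _ in_lattice _ (in_lattice_freudenthal i j k).

(** One or three unit steps change every coordinate by 1 or -1; two unit steps change a single
    coordinate by 2 or -2. *)
Lemma adjacent_fcell (a b d : bool) i j k : [|| a, b | d] ->
  adjacent_cells (fcell i j k) (fcell (i + a) (j + b) (k + d)).
Proof.
have E (l : 'I_3) :
    (\val (fcell i j k) - \val (fcell (i + a) (j + b) (k + d))) ord0 l =
    - [:: a%:Z + b%:Z - d%:Z; a%:Z - b%:Z + d%:Z; a%:Z - b%:Z - d%:Z]`_l.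
  by move: l; apply: ord3P; rewrite !mxE inordK//=; lia.
move=> abd; have [even|odd] := boolP (a (+) b (+) d); apply/orP; [right|left].
  apply/forallP; apply: ord3P; rewrite !E inordK//=;
  by move: a b d {E} abd even => [] [] [].
apply/existsP; exists (inord (if a then (if b then 0 else 1) else 2)).
move: a b d E abd odd => [] [] [] // E _ _; apply/orP; [right|right|left];
  apply/eqP/rowP; apply: ord3P; rewrite E ?mulNrn !mxE /= !inordK//=
  -?val_eqE /= ?inordK//.
Qed.

Section flux.
Variables (c : coloring) (G : set {fset cell}).
Hypothesis G_step : forall x y, G x -> tricolor_step c x y -> G y.

Definition tricolor a b d := [&& c a != c b, c b != c d & c a != c d].

(* The mod 2 cocycle dual to the tricolor loops that meet G. *)
Definition flux a b d : bool := tricolor a b d &&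
  `[< exists x, [/\ G x, is_vertex x & [/\ a \in x, b \in x & d \in x]] >].

(** Two distinct vertices containing the same tricolor triangle are joined by a tricolor step, so
    [G] contains both or neither. Any vertex around the triangle thus decides its flux. *)
Lemma flux_vertex X a b d : is_vertex X -> a \in X -> b \in X -> d \in X ->
  flux a b d = tricolor a b d && `[< G X >].
Proof.
move=> vX aX bX dX; rewrite /flux; case: (boolP (tricolor a b d)) => //= tri.
apply/asboolP/asboolP => [[x [Gx vx [ax bx dx]]]|GX]; last by exists X.
have [<-//|xX] := eqVneq x X.
apply: (G_step Gx); split=> //; exists [fset a; b; d]%fset.
have /and3P[ab bd ad] := tri.
have mem3 v : v \in [fset a; b; d]%fset -> [\/ v = a, v = b | v = d].
  by rewrite in_fset3 => /or3P[] /eqP; [constructor 1|constructor 2|constructor 3].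
split.
- split; first split.
  + apply: cardfs3; rewrite /= !inE negb_or andbT -andbA.
    by apply/and3P; split; [apply: contraNneq ab|apply: contraNneq ad|
      apply: contraNneq bd] => ->.
  + move=> v w /mem3 vE /mem3 wE; apply: vX.2.
      by case: vE => ->.
    by case: wE => ->.
  + by move=> v w /mem3[] -> /mem3[] -> //  E; move: ab bd ad; rewrite E eqxx.
- by apply/fsubsetP => v /mem3[] ->.
- by apply/fsubsetP => v /mem3[] ->.
Qed.

(** The four triangles agree on membership of their common vertex in [G], and a 3-coloring of four
    cells has zero or two tricolor triangles. *)
Lemma flux_cocycle a b d e : is_vertex [fset a; b; d; e]%fset ->
  flux a b d = flux b d e (+) flux a d e (+) flux a b e.
Proof.
move=> vX; have X u := in_fset4 a b d e u.
rewrite !(flux_vertex vX) ?X ?eqxx ?orbT//.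
case: asboolP => _; rewrite ?andbT ?andbF// /tricolor.
by move: (c a) (c b) (c d) (c e); do 4 case=> [[|[|[|//]]] ?].
Qed.

(** The cube is cut into six tetrahedra around the diagonal from [v] to [w]. Each interior triangle
    contains the diagonal and lies in two of them, so in the sum of the six cocycle relations only
    the faces of the cube remain. *)
Lemma flux_cube (v v1 v2 v3 v12 v13 v23 w : cell) :
  is_vertex [fset v; v1; v12; w]%fset -> is_vertex [fset v; v2; v12; w]%fset ->
  is_vertex [fset v; v1; v13; w]%fset -> is_vertex [fset v; v3; v13; w]%fset ->
  is_vertex [fset v; v2; v23; w]%fset -> is_vertex [fset v; v3; v23; w]%fset ->
  (flux v v1 v12 (+) flux v v2 v12) (+) (flux v3 v13 w (+) flux v3 v23 w) =
  ((flux v v1 v13 (+) flux v v3 v13) (+) (flux v2 v12 w (+) flux v2 v23 w)) (+)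
  ((flux v v2 v23 (+) flux v v3 v23) (+) (flux v1 v12 w (+) flux v1 v13 w)).
Proof.
move=> /flux_cocycle -> /flux_cocycle -> /flux_cocycle -> /flux_cocycle ->.
move=> /flux_cocycle -> /flux_cocycle ->.
move: (flux v1 v12 w) (flux v1 v13 w) (flux v2 v12 w) (flux v2 v23 w).
move: (flux v3 v13 w) (flux v3 v23 w) (flux v v12 w) (flux v v13 w).
move: (flux v v23 w) (flux v v1 w) (flux v v2 w) (flux v v3 w).
by do 12 case.
Qed.

End flux.

Lemma adjacent_step i j k i' j' k' : (i <= i' <= i.+1)%N ->
  (j <= j' <= j.+1)%N -> (k <= k' <= k.+1)%N -> (i + j + k < i' + j' + k')%N ->
  adjacent_cells (fcell i j k) (fcell i' j' k').
Proof.
move=> ii jj kk lt.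
have -> : i' = (i + (i < i'))%N by lia.
have -> : j' = (j + (j < j'))%N by lia.
have -> : k' = (k + (k < k'))%N by lia.
by apply: adjacent_fcell; lia.
Qed.

(** * Telescoping sums modulo 2 *)

Section parity.
Local Open Scope nat_scope.

Lemma sumb_telescope N (f : nat -> bool) :
  \big[addb/false]_(i < N) (f i (+) f i.+1) = f 0 (+) f N.
Proof.
elim: N => [|N IH]; first by rewrite big_ord0 addbb.
by rewrite big_ord_recr /= IH addbA addbK.
Qed.

(** Discrete Stokes formula: inner sides of the grid squares occur twice and cancel. *)
Lemma sumb_square N (f g : nat -> nat -> bool) :
  \big[addb/false]_(i < N) \big[addb/false]_(j < N)
    ((f i j (+) f i j.+1) (+) (g i j (+) g i.+1 j)) =
  (\big[addb/false]_(i < N) (f i 0 (+) f i N)) (+)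
  (\big[addb/false]_(j < N) (g 0 j (+) g N j)).
Proof.
under eq_bigr do rewrite big_split /=.
rewrite big_split /=; congr addb.
  by apply: eq_bigr => i _; rewrite sumb_telescope.
by rewrite exchange_big; apply: eq_bigr => j _; rewrite (sumb_telescope N (g^~ j)).
Qed.

End parity.

(** * Parity of the flux through the layers of a prism *)

Section prism.
Variables (c : coloring) (N : nat).
(** Sperner boundary conditions at every height: each lateral side misses a color. The corners (0,
    0) and (N, 0) are forced to have colors 0 and 1, and the whole side j = N has color 2. *)
Hypothesis side_j0 : forall i k, (i <= N)%N -> c (fcell i 0 k) != inord 2.
Hypothesis side_iN : forall j k, (j <= N)%N -> c (fcell N j k) != inord 0.
Hypothesis side_i0 : forall j k, (j <= N)%N -> c (fcell 0 j k) != inord 1.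
Hypothesis side_jN : forall i k, (i <= N)%N -> c (fcell i N k) = inord 2.

(** The vertices reached by tricolor paths from the bottom face. Paths extend, so this set is closed
    under tricolor steps and yields a cocycle. *)
Let G : set {fset cell} := [set x | exists y s, [/\ is_vertex y,
  (exists i j, [/\ (i <= N)%N, (j <= N)%N & fcell i j 0 \in y]),
  tricolor_path c y s & last y s = x]].

Let G_step x y : G x -> tricolor_step c x y -> G y.
Proof.
move=> [z [s [vz zb zs lx]]] xy; exists z, (rcons s y); split=> //.
  by move: zs; rewrite /tricolor_path rcons_path lx => ->; exact/asboolP.
by rewrite last_rcons.
Qed.

Local Notation flx := (flux c G).

Let horizontal i j k := flx (fcell i j k) (fcell i.+1 j k) (fcell i.+1 j.+1 k) (+)
  flx (fcell i j k) (fcell i j.+1 k) (fcell i.+1 j.+1 k).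
Let vertical1 k i j := flx (fcell i j k) (fcell i.+1 j k) (fcell i.+1 j k.+1) (+)
  flx (fcell i j k) (fcell i j k.+1) (fcell i.+1 j k.+1).
Let vertical2 k i j := flx (fcell i j k) (fcell i j.+1 k) (fcell i j.+1 k.+1) (+)
  flx (fcell i j k) (fcell i j k.+1) (fcell i j.+1 k.+1).

Let tri_not e a b d :
  c a != e -> c b != e -> c d != e -> tricolor c a b d = false.
Proof.
rewrite /tricolor; move: (c a) (c b) (c d) e.
by do 4 case=> [[|[|[|//]]] ?].
Qed.

Let flux_not e a b d : c a != e -> c b != e -> c d != e -> flx a b d = false.
Proof. by move=> ae be de; rewrite /flux (tri_not ae be de). Qed.

Let horizontalS i j k : horizontal i j k (+) horizontal i j k.+1 =
  (vertical1 k i j (+) vertical1 k i j.+1) (+)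
  (vertical2 k i j (+) vertical2 k i.+1 j).
Proof.
by apply: (flux_cube G_step); apply: quad_vertex; apply: adjacent_step; lia.
Qed.

Let layer k := \big[addb/false]_(i < N) \big[addb/false]_(j < N) horizontal i j k.

(** Summed over the cubes of a layer, inner vertical faces cancel, and the lateral ones carry no
    flux because each side misses a color. *)
Let layerS k : layer k.+1 = layer k.
Proof.
suff : layer k (+) layer k.+1 = false by case: (layer k); case: (layer k.+1).
rewrite /layer -big_split /=; under eq_bigr do rewrite -big_split /=.
under eq_bigr do under eq_bigr do rewrite horizontalS.
rewrite sumb_square !big1//= => i _;
  have iN := ltnW (ltn_ord i); have iN' := ltn_ord i.
  have -> : vertical2 k 0 i = false.
    by rewrite /vertical2 !(@flux_not (inord 1)) ?side_i0.
  by rewrite /vertical2 !(@flux_not (inord 0)) ?side_iN.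
have -> : vertical1 k i 0 = false.
  by rewrite /vertical1 !(@flux_not (inord 2)) ?side_j0.
by rewrite /vertical1 !(@flux_not (inord 1)) ?side_jN// -val_eqE /= !inordK.
Qed.

Let edge01 a b := ((c a == inord 0) && (c b == inord 1)) ||
  ((c a == inord 1) && (c b == inord 0)).

(** Sperner's parity: a triangle has an odd number of 01 edges exactly when it is tricolor, so
    modulo 2 [tricolor] is the coboundary of [edge01]. *)
Let tricolorE a b d : tricolor c a b d = edge01 a b (+) edge01 b d (+) edge01 a d.
Proof.
rewrite /tricolor /edge01; move: (c a) (c b) (c d).
by do 3 case=> [[|[|[|//]]] ?]; rewrite -!val_eqE /= !inordK.
Qed.

(** A vertex with a bottom cell belongs to [G] through the empty path. *)
Let flux_bottom i j a b e : (i <= N)%N -> (j <= N)%N ->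
  is_vertex [fset fcell i j 0; a; b; e]%fset ->
  flx (fcell i j 0) a b = tricolor c (fcell i j 0) a b.
Proof.
move=> iN jN vX; have X u := in_fset4 (fcell i j 0) a b e u.
rewrite (flux_vertex G_step vX) ?X ?eqxx ?orbT// (_ : `[< _ >] = true) ?andbT//.
apply/asboolP; exists [fset fcell i j 0; a; b; e]%fset, [::]; split=> //.
by exists i, j; rewrite X eqxx.
Qed.

Let edge1 i j := edge01 (fcell i j 0) (fcell i.+1 j 0).
Let edge2 i j := edge01 (fcell i j 0) (fcell i j.+1 0).

Let horizontal_bottom i j : (i < N)%N -> (j < N)%N ->
  horizontal i j 0 = (edge1 i j (+) edge1 i j.+1) (+) (edge2 i j (+) edge2 i.+1 j).
Proof.
move=> iN jN; rewrite /horizontal.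
rewrite (@flux_bottom i j _ _ (fcell i.+1 j.+1 1)); [|lia|lia|]; last first.
  by apply: quad_vertex; apply: adjacent_step; lia.
rewrite (@flux_bottom i j _ _ (fcell i.+1 j.+1 1)); [|lia|lia|]; last first.
  by apply: quad_vertex; apply: adjacent_step; lia.
rewrite !tricolorE /edge1 /edge2.
move: (edge01 _ (fcell i.+1 j.+1 0)) (edge01 _ (fcell i.+1 j.+1 0)).
move: (edge01 _ (fcell i.+1 j.+1 0)) (edge01 _ _) (edge01 _ _).
by do 5 case.
Qed.

(* Sperner's lemma on the bottom face. *)
Let layer0 : layer 0.
Proof.
rewrite /layer; under eq_bigr => i _.
  under eq_bigr => j _ do rewrite horizontal_bottom ?ltn_ord//.
  over.
have color i j k : c (fcell i j k) = inord 0 \/ c (fcell i j k) = inord 1 \/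
    c (fcell i j k) = inord 2.
  move: (c _); case=> [[|[|[|//]]] ?]; [left|right; left|right; right];
  by apply/val_inj; rewrite /= inordK.
have ne01 : (inord 0 == inord 1 :> 'I_3) = false by rewrite -val_eqE /= !inordK.
have ne10 : (inord 1 == inord 0 :> 'I_3) = false by rewrite -val_eqE /= !inordK.
rewrite sumb_square [X in _ (+) X]big1 ?addbF; last first.
  move=> j _; have jN := ltnW (ltn_ord j).
  rewrite /edge2 /edge01 (negbTE (side_iN _ jN)) (negbTE (side_i0 _ jN)).
  by rewrite (negbTE (side_iN _ (ltn_ord j))) (negbTE (side_i0 _ (ltn_ord j))) !andbF.
(* Only the side j = 0 contributes: its colors are 0 and 1, starting at 0 and ending at 1, so the
   number of changes is odd. *)
pose f i := c (fcell i 0 0) == inord 1.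
rewrite (eq_bigr (fun i : 'I_N => f i (+) f i.+1)) => [|i _]; last first.
  have -> : edge1 i N = false.
    rewrite /edge1 /edge01 (side_jN _ (ltnW (ltn_ord i))) (side_jN _ (ltn_ord i)).
    by rewrite -!val_eqE /= !inordK.
  rewrite addbF /edge1 /edge01.
  have := side_j0 0 (ltnW (ltn_ord i)); have := side_j0 0 (ltn_ord i); rewrite /f.
  by case: (color i 0 0) => [|[|]] ->; case: (color i.+1 0 0) => [|[|]] ->;
    rewrite ?eqxx // ?ne01 ?ne10.
rewrite sumb_telescope /f (negbTE (side_i0 _ _))//=.
have := side_j0 0 (leqnn N); have := side_iN 0 (leq0n N).
by case: (color N 0 0) => [|[|]] ->; rewrite ?eqxx.
Qed.

(** The layer at height [h] has odd flux, hence a triangle of nonzero flux, whose vertex in [G] ends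
    a path from the bottom. *)
Lemma prism_path h : exists x s i j i' j', [/\ is_vertex x, tricolor_path c x s,
  [/\ (i <= N)%N, (j <= N)%N & fcell i j 0 \in x] & fcell i' j' h \in last x s].
Proof.
have lh : layer h by elim: h => [|h IH]; [exact: layer0|rewrite layerS].
have [i [j hor]] : exists i j, horizontal i j h.
  apply: contrapT => /forallNP no; move: lh; rewrite /layer big1// => i _.
  by rewrite big1// => j _; apply/negP => H; apply: (no i); exists j.
have : exists a b, flx (fcell i j h) a b.
  have [E|NE] := boolP (flx (fcell i j h) (fcell i.+1 j h) (fcell i.+1 j.+1 h)).
    by exists (fcell i.+1 j h), (fcell i.+1 j.+1 h).
  move: hor; rewrite /horizontal (negbTE NE) => H.
  by exists (fcell i j.+1 h), (fcell i.+1 j.+1 h).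
case=> a [b /andP[_ /asboolP[x [Gx _ [ax _ _]]]]].
case: Gx => y [s [vy [i' [j' [iN jN yb]]] ys lx]].
by exists y, s, i', j', i, j; rewrite lx.
Qed.

End prism.

(** * Scaling of crossing probabilities *)

Definition box_cells (m : nat) : seq cell :=
  undup (pmap (insub : 'rV[int]_3 -> option cell)
    [seq \row_i ((f i)%:Z - m%:Z) | f : {ffun 'I_3 -> 'I_(2 * m).+1}]).

Lemma mem_box_cells m v : (v \in box_cells m) = in_box m v.
Proof.
rewrite mem_undup mem_pmap_sub; apply/mapP/in_boxP => [[f _ ->] i|vm].
  by rewrite mxE; case: (f i) => a /= am; lia.
have fP i : (absz (co v i + m%:Z)%R < (2 * m).+1)%N by have := vm i; lia.
exists [ffun i => Ordinal (fP i)]; first by rewrite mem_enum.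
apply/rowP => i; rewrite mxE ffunE /= gez0_abs ?addrK//.
by have := vm i; rewrite ler_norml => /andP[+ _]; rewrite -subr_ge0 opprK.
Qed.

Lemma box_cells_uniq m : uniq (box_cells m).
Proof. exact: undup_uniq. Qed.

Lemma near_of_common m (s t v w : cell) : in_box m v -> in_box m w ->
  cell_add s v = cell_add t w -> near_cells (2 * m) s t.
Proof.
move=> /in_boxP vm /in_boxP wm stE; apply/near_cellsP => i.
have : co (cell_add s v) i = co (cell_add t w) i by rewrite stE.
by rewrite !cell_addE; have := vm i; have := wm i; lia.
Qed.

Section crossing_prob.
Context {R : realType}.
Local Notation field := (cell -> 'I_3 -> R).
Local Notation indices := {ffun 'I_3 -> 'I_121}.
Implicit Types (q : field) (t v : cell) (n m : nat).

Definition crossing_prob q n : R :=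
  mean q (box_cells (3 * n + 2)) \1_(crossing n) (point : coloring).

Definition shift_field t q : field := fun v => q (cell_add t v).

Lemma probs_shift t q : probs q -> probs (shift_field t q).
Proof. by move=> pq v; exact: pq. Qed.

Lemma indic01 (A : set coloring) x : 0 <= (\1_A x : R) <= 1.
Proof. by rewrite indicE; case: (_ \in _); rewrite /= ?lexx ?ler01. Qed.

Lemma depends_on_crossing n : (0 < n)%N ->
  depends_on (box_cells (3 * n + 2)) (\1_(crossing n) : coloring -> R).
Proof.
move=> n0 x y xy; rewrite !indicE; congr (_%:R); congr nat_of_bool.
by apply/idP/idP => /set_mem H; apply/mem_set; apply: (crossing_local n0) H => v;
  rewrite -mem_box_cells => /xy.
Qed.

Lemma depends_on_crossing_at t n : (0 < n)%N ->
  depends_on (map (cell_add t) (box_cells (3 * n + 2)))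
    (\1_(crossing_at t n) : coloring -> R).
Proof.
move=> n0 x y xy.
have -> (z : coloring) : \1_(crossing_at t n) z =
    \1_(crossing n) (z \o cell_add t) :> R by rewrite !indicE.
have -> (z : coloring) : \1_(crossing_at t n) z =
    \1_(crossing n) (z \o cell_add t) :> R by rewrite !indicE.
by apply: (depends_on_crossing n0) => v vb /=; apply: xy; exact: map_f.
Qed.

(** The translation passes from the event to the field; a common list [s] allows several translates
    to be averaged together. *)
Lemma mean_crossing_at q t n s x : probs q -> (0 < n)%N -> uniq s ->
  (forall v, in_box (3 * n + 2) v -> cell_add t v \in s) ->
  mean q s \1_(crossing_at t n) x = crossing_prob (shift_field t q) n.
Proof.
move=> pq n0 us sP.
rewrite (mean_widen _ pq _ us _ (depends_on_crossing_at n0)); last first.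
- by move=> _ /mapP[v + ->]; rewrite mem_box_cells; exact: sP.
- by rewrite map_inj_uniq ?box_cells_uniq//; exact: cell_add_inj.
rewrite (_ : \1_(crossing_at t n) =
    fun y => (\1_(crossing n) : coloring -> R) (y \o cell_add t)); last first.
  by apply/funext => y; rewrite !indicE.
rewrite mean_reindex; last exact: cell_add_inj.
by apply: mean_const; exact: depends_on_crossing.
Qed.

Lemma mean_crossing q n s x : probs q -> (0 < n)%N -> uniq s ->
  (forall v, in_box (3 * n + 2) v -> v \in s) ->
  mean q s \1_(crossing n) x = crossing_prob q n.
Proof.
move=> pq n0 us sP; rewrite (mean_widen _ pq _ us _ (depends_on_crossing n0)).
- exact/mean_const/depends_on_crossing.
- exact: box_cells_uniq.
- by move=> v; rewrite mem_box_cells; exact: sP.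
Qed.

Lemma crossing_prob_ge0 q n : probs q -> 0 <= crossing_prob q n.
Proof.
move=> pq; rewrite -(mean_cst (box_cells (3 * n + 2)) 0 (point : coloring) pq).
by apply: mean_le => // y; have /andP[] := indic01 (crossing n) y.
Qed.

(** Grid centers have coordinates up to 120n, and 3n + 2 is at most 5n. *)
Lemma grid_support n m (z : indices) v : (n <= m)%N -> (0 < n)%N ->
  in_box (3 * n + 2) v -> cell_add (grid n z) v \in box_cells (130 * m).
Proof.
move=> nm n0 /in_boxP vn; rewrite mem_box_cells; apply/in_boxP => i.
rewrite cell_addE gridE; have := vn i; have := ltn_ord (z i); nia.
Qed.


Definition scale_const : R := #|{: indices * indices}|%:R.

Lemma scale_const_ge1 : 1 <= scale_const.
Proof.
rewrite ler1n; apply/card_gt0P.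
by exists ([ffun=> ord0], [ffun=> ord0]).
Qed.

(** Union bound over the pairs of far grid centers from [crossing_scale], at most [scale_const]
    many; each term factors because the supports are disjoint. *)
Lemma crossing_prob_scale q n m (a : R) : probs q -> (0 < n)%N ->
  (6 * n <= m <= 36 * n)%N ->
  (forall t, crossing_prob (shift_field t q) n <= a) ->
  crossing_prob q m <= scale_const * a ^+ 2.
Proof.
move=> pq n0 nm qa; pose s := box_cells (130 * m).
have us : uniq s by exact: box_cells_uniq.
rewrite -(@mean_crossing q m s point)//; [|lia|]; last first.
  by move=> v /in_boxP vm; rewrite mem_box_cells; apply/in_boxP => i; have := vm i; lia.
pose far (u : indices * indices) := ~~ near_cells (6 * n + 4) (grid n u.1) (grid n u.2).
pose r := [seq u <- enum {: indices * indices} | far u].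
pose F (u : indices * indices) (y : coloring) : R :=
  \1_(crossing_at (grid n u.1) n) y * \1_(crossing_at (grid n u.2) n) y.
have F0 u y : 0 <= F u y.
  by apply: mulr_ge0; [have /andP[] := indic01 (crossing_at (grid n u.1) n) y|
    have /andP[] := indic01 (crossing_at (grid n u.2) n) y].
apply: (@le_trans _ _ (mean q s (fun y => \sum_(u <- r) F u y) point)).
  apply: mean_le => // y; rewrite indicE.
  have [/set_mem cy|_] := boolP (_ \in _); last by apply: sumr_ge0.
  have [z [z' [cz cz' zz']]] := crossing_scale n0 nm cy.
  have zr : (z, z') \in r by rewrite mem_filter mem_enum andbT.
  rewrite (big_rem _ zr)/= -[leLHS]addr0 lerD ?sumr_ge0//.
  by rewrite /F !indicE !mem_set//= mulr1.
rewrite mean_sum; apply: (@le_trans _ _ (\sum_(u <- r) a ^+ 2)).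
  rewrite !big_filter big_seq_cond [leRHS]big_seq_cond.
  apply: ler_sum => u /andP[_ uf].
  rewrite (@mean_mul _ _ _ q s
    (map (cell_add (grid n u.1)) (box_cells (3 * n + 2)))
    (map (cell_add (grid n u.2)) (box_cells (3 * n + 2))))//.
  - have nm' : (n <= m)%N by lia.
    rewrite !mean_crossing_at//; [|by move=> v; exact: grid_support..].
    by rewrite expr2; apply: ler_pM; rewrite ?crossing_prob_ge0//; exact: probs_shift.
  - exact: depends_on_crossing_at.
  - exact: depends_on_crossing_at.
  - move=> _ /mapP[v + ->]; rewrite mem_box_cells => vb.
    apply/negP => /mapP[w +]; rewrite mem_box_cells => wb vw.
    have := near_of_common vb wb vw.
    by rewrite (_ : 2 * (3 * n + 2) = 6 * n + 4)%N ?(negbTE uf)//; lia.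
rewrite big_const_seq count_predT iter_addr_0 -mulr_natl ler_wpM2r ?sqr_ge0//.
by rewrite ler_nat size_filter (leq_trans (count_size _ _))// cardE.
Qed.

(** The value a at which the scaling bound [scale_const] a^2 equals a / 2. *)
Definition threshold : R := (2 * scale_const)^-1.

Lemma threshold_gt0 : 0 < threshold.
Proof. by rewrite invr_gt0 mulr_gt0// (lt_le_trans ltr01)// scale_const_ge1. Qed.

Lemma scale_threshold : scale_const * threshold = 2^-1.
Proof.
have C0 : scale_const != 0 by rewrite gt_eqF// (lt_le_trans ltr01)// scale_const_ge1.
by rewrite /threshold; field.
Qed.

(** Scaling needs a bound at every translate of the field, so the induction runs over a
    translation-invariant class. Each factor 6 in scale at least halves the bound. *)
Lemma crossing_prob_decay (Q : set field) n : (0 < n)%N ->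
  (forall q, Q q -> probs q) -> (forall q t, Q q -> Q (shift_field t q)) ->
  (forall q, Q q -> crossing_prob q n <= threshold) ->
  forall i q, Q q -> crossing_prob q (6 ^ i * n) <= threshold / 2 ^+ i.
Proof.
move=> n0 Qp Qs Qn; elim=> [|i IH] q Qq; first by rewrite expn0 mul1n divr1; exact: Qn.
have := @crossing_prob_scale q (6 ^ i * n) (6 ^ i.+1 * n) (threshold / 2 ^+ i) (Qp _ Qq).
move=> /(_ _ _ _)/le_trans; apply.
- by rewrite muln_gt0 expn_gt0.
- by rewrite expnS; lia.
- by move=> t; apply: IH; exact: Qs.
have -> : scale_const * (threshold / 2 ^+ i) ^+ 2 =
    (scale_const * threshold) * threshold / 2 ^+ i / 2 ^+ i.
  by field; rewrite expf_neq0.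
rewrite scale_threshold exprS invfM.
rewrite [leLHS](_ : _ = threshold * (2^-1 / 2 ^+ i) * (2 ^+ i)^-1); last by ring.
rewrite ler_piMr ?invf_le1 ?exprn_gt0 ?exprn_ege1 ?ler1n//.
by rewrite mulr_ge0 ?ltW ?threshold_gt0// ?mulr_gt0 ?invr_gt0 ?exprn_gt0.
Qed.

End crossing_prob.

(** * Closedness and uniform smallness *)

Section phases.
Context {R : realType}.
Local Notation field := (cell -> 'I_3 -> R).
Local Notation indices := {ffun 'I_3 -> 'I_121}.
Local Notation threshold := (@threshold R).
Implicit Types (p : 'rV[R]_3) (n m : nat).

Definition homogeneous p : field := fun=> p ord0.

Lemma probs_homogeneous p : simplex R 3 p -> probs (homogeneous p).
Proof. by move=> [p01 p1] v; split=> // c; have /andP[] := p01 c. Qed.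

Lemma coloring_law_crossing (p : simplex R 3) n : (0 < n)%N ->
  coloring_law p (crossing n) = (crossing_prob (homogeneous (\val p)) n)%:E.
Proof.
move=> n0; apply: iid_law_mean; first exact: box_cells_uniq.
exact: depends_on_crossing.
Qed.

Lemma homogeneous_decay p n i : simplex R 3 p -> (0 < n)%N ->
  crossing_prob (homogeneous p) n <= threshold ->
  crossing_prob (homogeneous p) (6 ^ i * n) <= threshold / 2 ^+ i.
Proof.
move=> sp n0 pn.
apply: (@crossing_prob_decay R [set homogeneous p] n) => //.
- by move=> _ ->; exact: probs_homogeneous.
- by move=> _ t ->.
- by move=> _ ->.
Qed.

Lemma exp2_small (e : R) : 0 < e -> exists i, (2 ^+ i)^-1 < e.
Proof.
move=> e0; exists (Num.bound e^-1).
rewrite invf_plt ?posrE ?exprn_gt0//.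
have := @archi_boundP R e^-1; rewrite invr_ge0 => /(_ (ltW e0))/lt_le_trans; apply.
by rewrite -natrX ler_nat ltnW// ltn_expl.
Qed.

(** Finite-size criterion: a single value below [threshold] forces decay to 0 along the scales 6^i
    n, against any positive lower bound. *)
Lemma extended_phaseP (p : simplex R 3) : extended_phase p <->
  forall n, (0 < n)%N -> threshold <= crossing_prob (homogeneous (\val p)) n.
Proof.
have sp : simplex R 3 (\val p) by have /set_mem := valP p.
split=> [[r r0 rP] n n0|H]; last first.
  exists threshold; first exact: threshold_gt0.
  by move=> n n0; rewrite coloring_law_crossing// lee_fin; exact: H.
rewrite leNgt; apply/negP => pn.
have [i iP] : exists i, (2 ^+ i)^-1 < r / threshold.
  by apply: exp2_small; rewrite divr_gt0// threshold_gt0.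
have := homogeneous_decay i sp n0 (ltW pn).
have : (0 < 6 ^ i * n)%N by rewrite muln_gt0 expn_gt0.
move=> /[dup] m0 /rP; rewrite coloring_law_crossing// lee_fin => /le_trans H /H.
by apply/negP; rewrite -ltNge mulrC -ltr_pdivlMr// threshold_gt0.
Qed.

Lemma continuous_crossing_prob n :
  continuous (fun p => crossing_prob (homogeneous p) n).
Proof. exact: continuous_mean. Qed.

Lemma closed_extended_phase : closed (@extended_phase R).
Proof.
rewrite (_ : @extended_phase R = \bigcap_(n in [set n | (0 < n)%N])
    (fun p : simplex R 3 => crossing_prob (homogeneous (\val p)) n) @^-1`
      [set x | threshold <= x]); last first.
  by apply/seteqP; split=> p /extended_phaseP.
apply: closed_bigI => n _; apply: preimage_closed; last exact: closed_ge.
move=> p _; apply: (@continuous_comp _ _ _ (fun p : simplex R 3 => \val p)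
  (fun p => crossing_prob (homogeneous p) n)).
  exact: initial_continuous.
exact: continuous_crossing_prob.
Qed.

Lemma compact_simplex : compact (simplex R 3).
Proof.
rewrite (_ : simplex R 3 = [set p : 'rV[R]_3 | forall i, `[0, 1]%classic (p ord0 i)] `&`
    (fun p : 'rV[R]_3 => \sum_i p ord0 i) @^-1` [set 1]); last first.
  apply/seteqP; split=> p.
    by case=> p01 p1; split=> // i; rewrite /= in_itv; exact: p01.
  by case=> p01 p1; split=> // i; have := p01 i; rewrite /= in_itv.
apply: compact_closedI.
  by apply: (@rV_compact R 3 (fun=> `[0, 1]%classic)) => i; exact: segment_compact.
apply: preimage_closed; last exact: closed_eq.
move=> p _; under eq_fun do rewrite !big_ord_recl big_ord0 addr0.
by do 2 (apply: (@continuousD R _ _ _ _ p); first exact: coord_continuous);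
  exact: coord_continuous.
Qed.

(** Each p falls below [threshold] at some power of 6 and stays below at all later ones. This is an
    open condition on p, so compactness gives a common power. *)
Lemma uniform_scale : @extended_phase R = set0 ->
  exists2 n, (0 < n)%N & forall p, simplex R 3 p ->
    crossing_prob (homogeneous p) n <= threshold / 2.
Proof.
move=> ext0.
have pos i : (0 < 6 ^ i)%N by rewrite expn_gt0.
have sub p : simplex R 3 p -> exists i, crossing_prob (homogeneous p) (6 ^ i) < threshold.
  move=> sp; have [n n0 pn] : exists2 n, (0 < n)%N &
      crossing_prob (homogeneous p) n < threshold.
    have : ~ extended_phase (exist (fun x => x \in simplex R 3) p (mem_set sp)).
      by rewrite ext0.
    move=> /extended_phaseP/existsNP[n /not_implyP[n0 /negP]].
    by rewrite -ltNge; exists n.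
  (* The window from 6n to 36n contains a power of 6, so one scaling step moves any n to the powers
     of 6, common to all p. *)
  have [i ni] : exists i, (6 * n <= 6 ^ i <= 36 * n)%N.
    exists (up_log 6 (6 * n)); rewrite up_logP//=.
    have n6 : (1 < 6 * n)%N by lia.
    have := @up_log_gtn 6 _ isT n6; have := up_log_gt0 6 (6 * n); rewrite n6 /=.
    by case: up_log => // j _; rewrite /= expnS; lia.
  exists i; apply: le_lt_trans (crossing_prob_scale (a := threshold) _ n0 ni _) _.
  - exact: probs_homogeneous.
  - by move=> t; exact: ltW.
  - rewrite expr2 mulrA scale_threshold mulrC gtr_pMr ?threshold_gt0//.
    by rewrite invf_lt1// ltr1n.
have /compact_near_coveringP/(_ nat \oo (fun j p => simplex R 3 p ->
    crossing_prob (homogeneous p) (6 ^ j) < threshold) _) := compact_simplex.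
have step p i j : simplex R 3 p -> (i <= j)%N ->
    crossing_prob (homogeneous p) (6 ^ i) < threshold ->
    crossing_prob (homogeneous p) (6 ^ j) < threshold.
  move=> sp /subnK <- pi; have := homogeneous_decay (j - i) sp (pos i) (ltW pi).
  rewrite -expnD; have [->//|ji] := posnP (j - i)%N; move=> /le_lt_trans; apply.
  by rewrite gtr_pMr ?threshold_gt0// invf_lt1 ?exprn_gt0// exprn_egt1 ?ltr1n// -lt0n.
case.
  move=> p sp; have [i pi] := sub p sp.
  have : \forall p' \near p, crossing_prob (homogeneous p') (6 ^ i) < threshold.
    have := @continuous_crossing_prob (6 ^ i) p.
    by move=> /(_ [set x | x < threshold]); apply; exact: lt_nbhsl.
  move=> U; exists ([set p' | crossing_prob (homogeneous p') (6 ^ i) < threshold],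
    [set j | (i <= j)%N]).
    by split=> //=; exists i.
  by move=> [p' j] /= [p'U ij] sp'; exact: (step p' i j).
(* One further scale halves the bound, which leaves room for a perturbation of the field. *)
move=> i _ iP; exists (6 ^ i.+1)%N => // p sp.
have := homogeneous_decay 1 sp (pos i) (ltW (iP i (leqnn i) p sp sp)).
by rewrite expr1 expn1 -expnS.
Qed.

End phases.

(** * Non-emptiness *)

Section sperner_field.
Context {R : realType}.
Local Notation indices := {ffun 'I_3 -> 'I_121}.
Implicit Types (a b : R) (N m n : nat).

Definition clamp a : R := Num.max 0 (Num.min 1 a).

Lemma clamp01 a : 0 <= clamp a <= 1.
Proof. by rewrite /clamp le_max lexx ge_max ler01 ge_min lexx. Qed.

Lemma clamp_id a : 0 <= a <= 1 -> clamp a = a.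
Proof. by move=> /andP[a0 a1]; rewrite /clamp min_r// max_r. Qed.

Lemma clamp_dist a b : `|clamp a - clamp b| <= `|a - b|.
Proof.
rewrite ler_norml /clamp; have := ler_norm (a - b); have := ler_norm (b - a).
rewrite distrC => ba ab.
by case: (leP 1 a); case: (leP 1 b); case: (leP 0 a); case: (leP 0 b); case: (leP (0 : R) 1);
  move=> *; apply/andP; split; lra.
Qed.

Lemma mul_dist a b a' b' : 0 <= a <= 1 -> 0 <= b' <= 1 ->
  `|a * b - a' * b'| <= `|a - a'| + `|b - b'|.
Proof.
move=> /andP[a0 a1] /andP[b0 b1].
have -> : a * b - a' * b' = (a - a') * b' + a * (b - b') by ring.
rewrite (le_trans (ler_normD _ _))// !normrM lerD//.
  by rewrite ler_piMr// ger0_norm.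
by rewrite ler_piMl// ger0_norm.
Qed.

(* The square [0, N] x [0, N] in the first two Freudenthal coordinates is
   mapped onto the simplex of probability vectors: its corners are
   monochromatic and each side sees at most two colors. *)
Definition sperner_field N (v : cell) (c : 'I_3) : R :=
  let s := clamp ((co v (inord 0) + co v (inord 1))%:~R / (2 * N%:R)) in
  let t := clamp ((co v (inord 0) - co v (inord 2))%:~R / (2 * N%:R)) in
  [:: (1 - s) * (1 - t); s * (1 - t); t]`_c.

Lemma probs_sperner_field N : probs (sperner_field N).
Proof.
move=> v; rewrite /sperner_field.
set s := clamp _; set t := clamp _.
have /andP[s0 s1] : 0 <= s <= 1 by exact: clamp01.
have /andP[t0 t1] : 0 <= t <= 1 by exact: clamp01.
split; last by rewrite !big_ord_recl big_ord0 /=; ring.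
by case=> [[|[|[|//]]] ?] /=; rewrite ?mulr_ge0 ?subr_ge0.
Qed.

(** A shift by at most L in each coordinate moves both arguments of [clamp] by at most 2L / (2N),
    and each entry is at most a product of two such factors. *)
Lemma sperner_field_dist N L (v w : cell) (c : 'I_3) : (0 < N)%N -> in_box L v ->
  `|sperner_field N (cell_add w v) c - sperner_field N w c| <= (2 * L)%:R / N%:R.
Proof.
move=> N0 /in_boxP vL; rewrite /sperner_field !cell_addE.
have N0R : 0 < N%:R :> R by rewrite ltr0n.
have dist (z z' : int) : `|z' - z| <= (2 * L)%:Z ->
    `|clamp (z'%:~R / (2 * N%:R)) - clamp (z%:~R / (2 * N%:R))| <= L%:R / N%:R.
  move=> zz; rewrite (le_trans (clamp_dist _ _))// -mulrBl -intrB normrM.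
  rewrite [X in _ * X]ger0_norm ?invr_ge0 ?mulr_ge0// invfM mulrA ler_pM2r ?invr_gt0//.
  rewrite ler_pdivrMr// -intr_norm mulrC -natrM.
  by rewrite -(ler_int R) in zz.
set s := clamp _; set t := clamp _; set s' := clamp _; set t' := clamp _.
have ss : `|s - s'| <= L%:R / N%:R.
  by apply: dist; have := vL (inord 0); have := vL (inord 1); lia.
have tt : `|t - t'| <= L%:R / N%:R.
  by apply: dist; have := vL (inord 0); have := vL (inord 2); lia.
have /andP[s0 s1] : 0 <= s <= 1 by exact: clamp01.
have /andP[t0 t1] : 0 <= t' <= 1 by exact: clamp01.
have {ss tt} : `|s - s'| + `|t - t'| <= (2 * L)%:R / N%:R.
  by rewrite (natrM _ 2 L); lra.
case: c => [[|[|[|//]]] ?] /=; apply: le_trans.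
- have -> : `|s - s'| = `|(1 - s) - (1 - s')| by rewrite distrC; congr `|_|; ring.
  have -> : `|t - t'| = `|(1 - t) - (1 - t')| by rewrite distrC; congr `|_|; ring.
  by apply: mul_dist; lra.
- have -> : `|t - t'| = `|(1 - t) - (1 - t')| by rewrite distrC; congr `|_|; ring.
  by apply: mul_dist; lra.
- by rewrite lerDr.
Qed.

Lemma fcellE i j k :
  [/\ co (fcell i j k) (inord 0) = i%:Z + j%:Z - k%:Z,
    co (fcell i j k) (inord 1) = i%:Z - j%:Z + k%:Z &
    co (fcell i j k) (inord 2) = i%:Z - j%:Z - k%:Z].
Proof. by split; rewrite mxE inordK. Qed.

(** The two combinations of coordinates in [sperner_field] are 2i and 2j, so the field is constant
    in the height k. *)
Lemma sperner_fieldE N i j k (c : 'I_3) : (0 < N)%N -> (i <= N)%N -> (j <= N)%N ->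
  let s := i%:R / N%:R in let t := j%:R / N%:R in
  sperner_field N (fcell i j k) c = [:: (1 - s) * (1 - t); s * (1 - t); t]`_c.
Proof.
move=> N0 iN jN s t; rewrite /sperner_field; have [-> -> ->] := fcellE i j k.
have N0R : 0 < N%:R :> R by rewrite ltr0n.
have ratio (l : nat) (z : int) : (l <= N)%N -> z = 2 * l%:Z ->
    clamp (z%:~R / (2 * N%:R)) = l%:R / N%:R.
  move=> lN ->; rewrite intrM -mulf_div divff ?mul1r ?pnatr_eq0// clamp_id//.
  by rewrite divr_ge0//= ler_pdivrMr// mul1r ler_nat.
by rewrite (ratio i) ?(ratio j)//; lia.
Qed.

Lemma sperner_field_path N h (c : coloring) : (0 < N)%N ->
  (forall v, sperner_field N v (c v) != 0) ->
  exists x s i j i' j', [/\ is_vertex x, tricolor_path c x s,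
  [/\ (i <= N)%N, (j <= N)%N & fcell i j 0 \in x] & fcell i' j' h \in last x s].
Proof.
move=> N0 c_pos; have NN : N%:R != 0 :> R by rewrite pnatr_eq0 -lt0n.
have ne v d : sperner_field N v d = 0 -> c v != d.
  by move=> vd; apply: contra_neqN (c_pos v) => /eqP ->; rewrite vd.
apply: prism_path => [i k iN|j k jN|j k jN|i k iN].
- by apply: ne; rewrite sperner_fieldE//= inordK//= mul0r.
- by apply: ne; rewrite sperner_fieldE//= inordK//= divff// subrr mul0r.
- by apply: ne; rewrite sperner_fieldE//= inordK//= !mul0r.
- have n0 : c (fcell i N k) != inord 0.
    by apply: ne; rewrite sperner_fieldE//= inordK//= divff// subrr mulr0.
  have n1 : c (fcell i N k) != inord 1.
    by apply: ne; rewrite sperner_fieldE//= inordK//= divff// subrr mulr0.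
  move: (c _) n0 n1; case=> [[|[|[|//]]] l3]; rewrite -?val_eqE /= !inordK//.
  by move=> _ _; apply/val_inj; rewrite /= inordK.
Qed.

Lemma sperner_field_crossing m (c : coloring) : (0 < m)%N ->
  (forall v, sperner_field m v (c v) != 0) ->
  exists z : indices, crossing_at (grid m z) m c.
Proof.
(* The second coordinate minus the third is twice the height: 0 at the start and 8m + 2 at the end.
   Being within m of the grid point at the start and within 3m at the end would allow a change of at
   most 2m + 6m. *)
move=> m0 /(sperner_field_path (4 * m + 1) m0).
move=> [x [s [i [j [i' [j' [vx xs [iN jN ux] wl]]]]]]].
have [u0 u1 u2] := fcellE i j 0; have [w0 w1 w2] := fcellE i' j' (4 * m + 1).
have [z uz] : exists z, near_cells m (fcell i j 0) (grid m z).
  by apply: near_grid => //; apply/in_boxP; apply: ord3P; lia.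
exists z; apply: (crossing_at_of_path m0 vx xs); first by exists (fcell i j 0).
exists (fcell i' j' (4 * m + 1)) => //; apply/negP => /near_cellsP wz.
move/near_cellsP: uz => uz.
have := uz (inord 1); have := uz (inord 2); have := wz (inord 1); have := wz (inord 2).
rewrite u1 u2 w1 w2; move: (co (grid m z) _) (co (grid m z) _) => g1 g2.
by clear; lia.
Qed.

(** Almost surely a crossing occurs around some grid point, so by the union bound one of these
    events has at least the average probability. *)
Lemma sperner_field_crossing_prob m : (0 < m)%N ->
  exists z : indices, (#|{: indices}|%:R)^-1 <=
    crossing_prob (shift_field (grid m z) (sperner_field m)) m.
Proof.
move=> m0; apply: contrapT => /forallNP no.
pose s := box_cells (130 * m).
have pq := probs_sperner_field m.
have /choice[x0 x0P] (v : cell) : exists d, sperner_field m v d != 0 :> R.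
  apply: contrapT => /forallNP v0; have := (pq v).2.
  rewrite big1 => [/eqP|d _]; first by rewrite eq_sym oner_eq0.
  by apply/eqP; apply: contrapT => /negP; exact: v0.
have := @mean_positive R _ _ (sperner_field m) s
  (\1_(\bigcup_z crossing_at (grid m z) m)) x0 pq x0P.
have H : (forall y : coloring, (forall v, sperner_field m v (y v) != 0) ->
    \1_(\bigcup_(z : indices) crossing_at (grid m z) m) y = 1 :> R).
  move=> y /(sperner_field_crossing m0)[z yz]; rewrite indicE mem_set//.
  by exists z.
move=> /(_ H) {}H.
have : mean (sperner_field m) s (\1_(\bigcup_(z : indices) crossing_at (grid m z) m)) x0
    <= mean (sperner_field m) s
      (fun y => \sum_(z : indices) \1_(crossing_at (grid m z) m) y) x0.
  apply: mean_le => // y; rewrite indicE.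
  have [/set_mem[z _ yz]|_] := boolP (_ \in _); last first.
    by apply: sumr_ge0 => z _; have /andP[] := @indic01 R (crossing_at (grid m z) m) y.
  have yz1 : \1_(crossing_at (grid m z) m) y = 1 :> R by rewrite indicE mem_set.
  rewrite (bigD1 z)//= yz1 lerDl; apply: sumr_ge0 => z' _.
  by have /andP[] := @indic01 R (crossing_at (grid m z') m) y.
rewrite H mean_sum; apply/negP; rewrite -ltNge.
have z0 : indices by exact: [ffun=> ord0].
have card0 : (#|{: indices}|%:R : R) != 0.
  by rewrite pnatr_eq0 -lt0n; apply/card_gt0P; exists z0.
rewrite -[ltRHS](@mulfV _ (#|{: indices}|%:R : R))// mulr_natl -sumr_const.
apply: ltr_sum => [|z _]; first by apply/hasP; exists z0; rewrite ?mem_index_enum.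
rewrite (mean_crossing_at _ pq)//; last by move=> v; exact: grid_support.
  by rewrite ltNge; apply/negP; exact: no.
exact: box_cells_uniq.
Qed.

Lemma extended_phase_neq0 : @extended_phase R !=set0.
Proof.
apply/set0P/eqP => /uniform_scale[n n0 nP].
(* The event at scale n depends on the box of radius L. If the field varies there by at most 2L / m,
   freezing it changes the probability by at most K / m. *)
pose L := (3 * n + 2)%N; pose K : R := (size (box_cells L) * 3)%:R * (2 * L)%:R.
(* The choice of i below gives K / m < [threshold] / 2, as m = 6^i n is at least 2^i; adding 1 to K
   keeps the divisor positive. *)
have K0 : 0 < K + 1 by rewrite ltr_wpDl// mulr_ge0.
have [i iP] : exists i, (2 ^+ i)^-1 < threshold / 2 / (K + 1) :> R.
  by apply: exp2_small; rewrite !divr_gt0// threshold_gt0.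
pose m := (6 ^ i * n)%N.
have m0 : (0 < m)%N by rewrite muln_gt0 expn_gt0.
pose e : R := (2 * L)%:R / m%:R.
(* Increments are bounded around every cell [w], which makes the class translation-invariant. *)
pose Q := [set q : cell -> 'I_3 -> R | probs q /\
  forall v w c, in_box L v -> `|q (cell_add w v) c - q w c| <= e].
have Qn q : Q q -> crossing_prob q n <= threshold.
  (* The field is frozen at its value at the origin [o]; the homogeneous bound and the cost of
     freezing are each at most [threshold] / 2. *)
  move=> [pq qe]; pose o := fcell 0 0 0; pose p : 'rV[R]_3 := \row_c q o c.
  have sp : simplex R 3 p.
    split=> [c|]; last by rewrite -[RHS](pq o).2; apply: eq_bigr => c _; rewrite mxE.
    rewrite mxE (pq o).1 -(pq o).2 (bigD1 c)//= lerDl sumr_ge0// => d _.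
    exact: (pq o).1.
  have := @mean_dist R _ _ q (homogeneous p) (box_cells L)
    (\1_(crossing n)) (point : coloring) e pq (probs_homogeneous sp).
  have g01 y : 0 <= (\1_(crossing n) y : R) <= 1 by exact: indic01.
  have oE v : cell_add o v = v.
    apply/val_inj/rowP => l; rewrite /= !mxE.
    by move: l; apply: ord3P; rewrite inordK//= !subr0 add0r.
  have close v c : v \in box_cells L -> `|q v c - homogeneous p v c| <= e.
    by rewrite mem_box_cells => /(qe v o c); rewrite oE /homogeneous mxE.
  move=> /(_ g01 close); rewrite -/(crossing_prob q n) -/(crossing_prob _ n) => d.
  have : (size (box_cells L) * 3)%:R * e <= threshold / 2.
    have mi : (m%:R : R)^-1 < threshold / 2 / (K + 1).
      apply: le_lt_trans iP; rewrite lef_pV2 ?posrE ?ltr0n ?exprn_gt0//.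
      rewrite -natrX ler_nat (leq_trans _ (leq_pmulr _ n0))//.
      by case: (i) => // l; rewrite leq_exp2r.
    rewrite /e mulrA -/K; move: mi; rewrite ltr_pdivlMr// => mi; apply/ltW.
    by apply: le_lt_trans mi; rewrite mulrC ler_wpM2l// ?invr_ge0// lerDl.
  have := nP p sp; have := ler_norm (crossing_prob q n - crossing_prob (homogeneous p) n).
  lra.
have [z] := sperner_field_crossing_prob m0; apply/negP; rewrite -ltNge.
apply: (@le_lt_trans _ _ (threshold / 2 ^+ i)).
  apply: (crossing_prob_decay n0 _ _ Qn) => [q []//|q t [pq qe]|].
    split=> [|v w c vL]; first exact: probs_shift.
    rewrite /shift_field (_ : cell_add t (cell_add w v) = cell_add (cell_add t w) v).
      exact: qe.
    by apply/val_inj; rewrite /= addrA.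
  split=> [|v w c vL]; first by apply: probs_shift; exact: probs_sperner_field.
  rewrite /shift_field (_ : cell_add (grid m z) (cell_add w v) =
    cell_add (cell_add (grid m z) w) v).
    exact: sperner_field_dist.
  by apply/val_inj; rewrite /= addrA.
have z0 : indices by exact: [ffun=> ord0].
have card0 : (0 < #|{: indices}|)%N by apply/card_gt0P; exists z0.
apply: (@le_lt_trans _ _ threshold).
  rewrite ler_piMr //; first exact/ltW/threshold_gt0.
  by rewrite invf_le1 ?exprn_gt0// exprn_ege1// ler1n.
(* With M grid indices, [threshold] is the inverse of 2 M^2, which is below the inverse of M. *)
rewrite /threshold ltf_pV2 ?posrE ?ltr0n//; last first.
  by rewrite mulr_gt0// (lt_le_trans ltr01)// scale_const_ge1.
rewrite /scale_const card_prod -natrM ltr_nat.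
by rewrite mulnA ltn_Pmull// (leq_trans _ (leq_pmulr _ card0)).
Qed.

End sperner_field.

Unset Implicit Arguments.

Theorem theorem1p4 (R : realType) :
  closed (@extended_phase R) /\ @extended_phase R !=set0.
Proof. by split; [exact: closed_extended_phase|exact: extended_phase_neq0]. Qed.
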